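(* Let $\alpha\in(0,\frac12]$, $\kappa=2^{\alpha-2}$, let $Z$ be the limit process and $S:=\sup_{t\in[0,1]}Z(t)$. Then for any $t>0$, $$\mathbf{P}\left(|S-\mathbb{E}[S]|\ge t\right)\le 2\exp\left(-\frac{1-\kappa}{2}t^2\right).$$ The same tail bounds are valid when $S$ is replaced by $S_n:=\sup_{t\in[0,1]}Z_n(t)$ for any $n\in\mathbb{N}$. The constant in the exponent on the right hand side is asymptotically optimal as $t\to\infty$, i.e. $\lim_{t\to\infty}t^{-2}\log\mathbf{P}(|S-\mathbb{E}[S]|\ge t)=-\frac{1-\kappa}{2}$. Moreover, $$\frac{\sqrt2}{\sqrt\pi(1-\sqrt\kappa)}\le\mathbb{E}[S]\le\sqrt{\frac{2}{1-2\kappa}},\qquad \mathrm{Var}(S)\le\frac{1}{1-\kappa}.$$ For $\alpha=1/2$, the bounds on the mean give $\mathbb{E}[S]\in[1.968\ldots,2.613\ldots]$.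
   Context: Binary expansions: each $t\in[0,1)$ is written in binary using the expansion containing infinitely many digits $0$; and $1=\sum_{i\ge1}2^{-i}$. Limit process: let $\Theta:=\bigcup_{k\ge0}\{0,1\}^k$ be the set of finite $0$-$1$ words, $|\vartheta|$ the length of $\vartheta$, and $B_\vartheta\subset[0,1]$ the set of numbers whose binary expansion has prefix $\vartheta$. Let $\{N_\vartheta:\vartheta\in\Theta\}$ be independent standard normal random variables and, for $n\ge0$, $t\in[0,1]$, $$Z_n(t):=\sum_{\vartheta\in\Theta:\,|\vartheta|<n}\left(\tfrac12\right)^{(1-\alpha/2)|\vartheta|}\left(\mathbf{1}_{\{t\in B_{\vartheta0}\}}-\mathbf{1}_{\{t\in B_{\vartheta1}\}}\right)N_\vartheta .$$ The limit process $Z$ is the almost sure uniform limit of $(Z_n)_{n\ge0}$ on $[0,1]$ (this limit exists). *)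

(* Defs.v *)
From HB Require Import structures.
From mathcomp Require Import all_boot all_order all_algebra.
From mathcomp Require Import all_classical all_reals all_analysis.

Set Implicit Arguments.
Unset Strict Implicit.
Unset Printing Implicit Defensive.

Import Order.TTheory GRing.Theory Num.Theory.
Import numFieldNormedType.Exports.

Local Open Scope classical_set_scope.
Local Open Scope ring_scope.

Section binary_expansions.
Context {R : realType}.

(* For t < 1 the expansion with infinitely many digits 0 is selected; for t = 1
   the series forces all digits to be 1. *)
Definition binary_expansion (t : R) (b : nat -> bool) : Prop :=
  series (fun i => (b i)%:R * (2^-1 : R) ^+ i.+1) @ \oo --> t /\
  (t < 1 -> forall m : nat, exists2 i : nat, (m <= i)%N & b i = false).

(* [true] stands for the digit 1. *)
Definition word_set (w : seq bool) : set R :=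
  [set t | 0 <= t <= 1 /\
     exists b : nat -> bool, binary_expansion t b /\ mkseq b (size w) = w].

End binary_expansions.

Section gaussian_families.
Context {R : realType} {d : measure_display} {T : measurableType d}.
Variable P : probability T R.

Definition mutually_independent (I : eqType) (X : I -> {RV P >-> R}) : Prop :=
  forall (s : seq I) (A : I -> set R), uniq s ->
    (forall i, measurable (A i)) ->
    P [set omega | forall i, i \in s -> A i (X i omega)] =
      (\prod_(i <- s) P (X i @^-1` A i))%E.

Definition standard_normal (X : {RV P >-> R}) : Prop :=
  forall A : set R, measurable A ->
    distribution P X A = normal_prob (0 : R) 1 A.

End gaussian_families.

Section limit_process.
Context {R : realType} {T : Type}.

(* The words of length k are enumerated by [k.-tuple bool]. *)
Definition Zproc (alpha : R) (N : seq bool -> T -> R) (n : nat) (t : R)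
    (omega : T) : R :=
  \sum_(k < n) \sum_(w : k.-tuple bool)
    (2^-1 : R) `^ ((1 - alpha / 2) * k%:R) *
    (\1_(word_set (rcons w false)) t - \1_(word_set (rcons w true)) t) *
    N w omega.

Definition sup01 (Y : R -> T -> R) (omega : T) : R :=
  sup [set Y t omega | t in `[0, 1]%classic].

End limit_process.

(* The limit is only determined almost surely; every version is allowed. *)
Definition is_limit_process {R : realType} {d : measure_display}
    {T : measurableType d} (P : probability T R) (alpha : R)
    (N : seq bool -> T -> R) (Z : R -> T -> R) : Prop :=
  {ae P, forall omega,
    {uniform `[0, 1]%classic,
      (fun n => fun t => Zproc alpha N n t omega) @ \oo --> Z ^~ omega}}.

(* Main.v *)
(** Put [q = sqrt kappa]. Evaluated along the binary expansion of its argument,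
    [Z_n] is a sum over a path of length [n] in the binary tree, so [S_n] is the
    maximum over the tree and satisfies
    [S_{n+1} = max (N + q S', - N + q S'')] with [N, S', S''] independent and
    [S', S''] distributed as [S_n].

    Concentration: the dual form of the quadratic transportation inequality with
    parameter [V] says that [E exp (g X) <= exp (E (f X))] as soon as
    [g x <= f y + (x - y)^2 / (2 V)]. A standard normal variable satisfies it for
    every [V > 1] (Prekopa-Leindler, proved by monotone transport), it
    tensorizes, and since
    [(y + q z)^2 <= y^2 / (1 - q^2) + z^2] the parameter [v / (1 - q^2)] is
    preserved by the recursion. Linear [f] and [g] then give
    [E exp (l (S_n - E S_n)) <= exp (l^2 / (2 (1 - kappa)))], from which the tails
    and the variance bound follow.

    Mean: [S_{n+1} >= |N| + q S'] or [|N| + q S''], according to the sign of [N],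
    gives the lower bound; bounding the square of the maximum by the sum of the
    squares gives [E S_{n+1}^2 <= 2 + 2 kappa E S_n^2], hence the upper bound.

    Optimality: [S_n] exceeds [u] when the normal variables at the nodes
    [0^i], [i < n], exceed [q^i u / (1 + kappa + ... + kappa^(n-1))].

    [S_n] increases to [S] almost surely, and everything passes to the limit by
    Fatou's lemma and dominated convergence. *)
Require Import Defs.
From HB Require Import structures.
From mathcomp Require Import all_boot all_order all_algebra.
From mathcomp Require Import all_classical all_reals all_analysis.
From mathcomp Require Import measurable_realfun ring lra zify.

Set Implicit Arguments.
Unset Strict Implicit.
Unset Printing Implicit Defensive.

Import Order.TTheory GRing.Theory Num.Theory.
Import numFieldNormedType.Exports.

Local Open Scope classical_set_scope.
Local Open Scope ring_scope.

(** * Gaussian transport *)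

(** A bound on [E exp (l X)] does not by itself pass through the maximum in the recursion. The dual
    transport inequality does: it compares two functions at two points, and the difference of two
    maxima is controlled by the difference along a single branch, so that only one of the two branch
    costs is spent. The constant [1 / (1 - kappa)] is the fixed point of [V = 1 + kappa V], that is,
    the variance of the sum along an infinite path. The Gaussian inequality is proved for [V > 1]
    because at [V = 1] the weight [1 - 1/V] in Prekopa-Leindler degenerates; [V] tends to 1 only
    after linear functions have been inserted. Restricting the inequality to Lipschitz functions
    keeps every integrand continuous and integrable, and the class is preserved when one variable is
    integrated out. *)

Section transport.
Context {R : realType}.
Implicit Types (F G W a b w : R -> R) (s c : R).

(** Convexity of the exponential, from its tangent at [s * d]: after division by [expR (s * d)] the
    linear terms of [1 + x <= expR x] cancel in the weighted mean. *)
Lemma weighted_expR_ge s d : 0 <= s <= 1 ->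
  expR (s * d) <= (1 - s) + s * expR d.
Proof.
move=> /andP[s0 s1].
have h1 := expR_ge1Dx (- (s * d)).
have h2 := expR_ge1Dx ((1 - s) * d).
have e1 : expR (s * d) * expR (- (s * d)) = 1.
  by rewrite -expRD subrr expR0.
have e2 : expR (s * d) * expR ((1 - s) * d) = expR d.
  by rewrite -expRD; congr expR; ring.
have -> : (1 - s) + s * expR d =
  expR (s * d) * ((1 - s) * expR (- (s * d)) + s * expR ((1 - s) * d)).
  transitivity ((1 - s) * (expR (s * d) * expR (- (s * d))) +
                s * (expR (s * d) * expR ((1 - s) * d))); last by ring.
  by rewrite e1 e2 mulr1.
rewrite ler_peMr ?expR_ge0//.
have : (1 - s) * (1 + - (s * d)) + s * (1 + (1 - s) * d) <=
   (1 - s) * expR (- (s * d)) + s * expR ((1 - s) * d).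
  by rewrite lerD// ler_wpM2l// subr_ge0.
by apply: le_trans; rewrite le_eqVlt; apply/orP; left; apply/eqP; ring.
Qed.

Lemma is_derive_ge0_homo (f df : R -> R) :
  (forall x : R, is_derive x 1 f (df x)) -> (forall x, 0 <= df x) ->
  {homo f : x y / x <= y}.
Proof.
move=> fdf df0 x y xy.
apply: (@ger0_derive1_ndecr _ f x y) => //.
- by move=> z _; rewrite derive1E derive_val.
- by apply: derivable_within_continuous => z _.
Qed.

Lemma is_derive_gt0_homo (f df : R -> R) :
  (forall x : R, is_derive x 1 f (df x)) -> (forall x, 0 < df x) ->
  {homo f : x y / x < y}.
Proof.
move=> fdf df0 x y xy.
apply: (@gtr0_derive1_incr _ f x y) => //.
- by move=> z _; rewrite derive1E derive_val.
- by apply: derivable_within_continuous => z _.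
Qed.

(* [T] transports the density [e^a] onto the density [e^b] and [z] interpolates
   between [x] and [T x]; the weighted AM-GM inequality makes [W (z x) - c F x]
   nondecreasing. *)
Lemma prekopa_leindler1 F G W a b w s c : 0 < s < 1 ->
  (forall x : R, is_derive x 1 F (expR (a x))) ->
  (forall x : R, is_derive x 1 G (expR (b x))) ->
  (forall x : R, is_derive x 1 W (w x)) ->
  (forall x, 0 <= W x <= 1) ->
  (forall x, exists y, G y = F x) ->
  (forall e : R, 0 < e -> exists x y, 1 - e < F y - F x) ->
  (forall x, 0 <= w x) -> 0 <= c ->
  (forall x y, c * expR ((1 - s) * a x + s * b y) <= w ((1 - s) * x + s * y)) ->
  c <= 1.
Proof.
move=> /andP[s0 s1] dF dG dW W01 FG F01 w0 c0 H.
have Ginc := is_derive_gt0_homo dG (fun x => expR_gt0 (b x)).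
have Ginj : injective G.
  by move=> x y Gxy; case: (ltgtP x y) => // /Ginc; rewrite Gxy ltxx.
have Fnd := is_derive_ge0_homo dF (fun x => expR_ge0 (a x)).
(* Inverse of [G] by choice; the default 0 is taken only outside the range of [G], which contains
   the range of [F]. *)
pose Gi (u : R) : R := xget 0 [set y | G y = u].
have GK : cancel G Gi.
  move=> y; rewrite /Gi; case: xgetP => [z _ /= /Ginj //|].
  by move=> /(_ y)/=.
pose T (x : R) : R := Gi (F x).
have GT x : G (T x) = F x.
  by rewrite /T; have [y <-] := FG x; rewrite GK.
have dGi (y : R) : is_derive (G y) 1 Gi (expR (b y))^-1.
  apply: is_derive_inverse => //; last by rewrite gt_eqF// expR_gt0.
  - by near=> t; exact: GK.
  - near=> z.
    apply: differentiable_continuous; apply/derivable1_diffP.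
    by have [] := dG z.
have dT (x : R) : is_derive x 1 T (expR (a x - b (T x))).
  rewrite expRB mulrC.
  apply: (@is_derive1_comp _ Gi F) => //.
  by rewrite -GT; exact: dGi.
pose z (x : R) : R := (1 - s) * x + s * T x.
have dz (x : R) : is_derive x 1 z ((1 - s) + s * expR (a x - b (T x))).
  rewrite /z.
  have -> : (fun x => (1 - s) * x + s * T x) = ((1 - s) \*: @id R) + (s \*: T).
    by [].
  apply: is_derive_eq.
  by rewrite [_%:A]mulr1.
pose Hf (x : R) : R := W (z x) - c * F x.
have dH (x : R) : is_derive x 1 Hf
  (w (z x) * ((1 - s) + s * expR (a x - b (T x))) - c * expR (a x)).
  rewrite /Hf.
  have -> : (fun y => W (z y) - c * F y) = (W \o z) - (c \*: F).
    by [].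
  have := is_derive1_comp (dW (z x)) (dz x) => ?.
  exact: is_deriveB.
have dH0 x : 0 <= w (z x) * ((1 - s) + s * expR (a x - b (T x))) - c * expR (a x).
  rewrite subr_ge0.
  apply: (@le_trans _ _ (w (z x) * expR (s * (a x - b (T x))))).
    apply: (@le_trans _ _ (c * expR ((1 - s) * a x + s * b (T x)) *
                           expR (s * (a x - b (T x))))).
      rewrite -mulrA -expRD.
      by rewrite (_ : _ + _ = a x)//; ring.
    by rewrite ler_wpM2r// expR_ge0.
  by rewrite ler_wpM2l// weighted_expR_ge// ltW//= ltW.
have Hnd := is_derive_ge0_homo dH dH0.
rewrite leNgt; apply/negP => c1.
(* For this [e] the increment of [F] exceeds [c^-1], whereas monotonicity of [Hf] and [0 <= W <= 1]
   bound [c] times the increment by 1. *)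
have [|x [y xy]] := F01 (1 - c^-1).
  by rewrite subr_gt0 invf_lt1// (lt_trans _ c1).
have : c * (F y - F x) <= 1.
  have [lexy|ltyx] := leP x y.
    have := Hnd _ _ lexy; rewrite /Hf.
    have := W01 (z x); have := W01 (z y).
    rewrite mulrBr; lra.
  have := Fnd _ _ (ltW ltyx) => h.
  have : c * (F y - F x) <= c * 0 by rewrite ler_wpM2l// subr_le0.
  by move=> /le_trans; apply; rewrite mulr0.
rewrite leNgt => /negP; apply.
have c_gt0 : 0 < c by rewrite (lt_trans _ c1).
rewrite -(@ltr_pM2l _ c) // in xy.
move: xy; rewrite opprB addrC subrK divff ?gt_eqF//.
Unshelve. all: by end_near. Qed.

End transport.

(** * Integration against densities and their primitives *)

Section densities.
Import HBNNSimple.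
Context {R : realType}.
Local Notation mu := (@lebesgue_measure R).

(** Both sides are limits over the same simple approximations by monotone convergence, and for
    indicators the claim is the hypothesis on [nu]. *)
Lemma ge0_integral_density (p : R -> R) (nu : {measure set R -> \bar R})
    (f : R -> \bar R) :
  (forall x, 0 <= p x) -> measurable_fun [set: R] p ->
  (forall A, measurable A -> nu A = (\int[mu]_(x in A) (p x)%:E)%E) ->
  measurable_fun [set: R] f -> (forall x, 0 <= f x)%E ->
  (\int[nu]_x f x = \int[mu]_x (f x * (p x)%:E))%E.
Proof.
move=> p0 mp nuE mf f0.
have mpE : measurable_fun [set: R] (fun x => (p x)%:E) by exact/measurable_EFinP.
pose f_ := nnsfun_approx measurableT mf.
have ndf_ x i j : (i <= j)%N -> f_ i x <= f_ j x.
  by move=> ij; exact/lefP/nd_nnsfun_approx.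
have mf_ n : measurable_fun [set: R] (fun x => (f_ n x)%:E).
  exact/measurable_EFinP.
transitivity (limn (fun n => \int[nu]_x (f_ n x)%:E))%E.
  rewrite -monotone_convergence//=.
  - apply: eq_integral => x _; apply/esym/cvg_lim => //=.
    exact: cvg_nnsfun_approx.
  - by move=> n ? _; rewrite lee_fin.
  - by move=> ? _ ? ? mn; rewrite lee_fin; exact: ndf_.
transitivity (limn (fun n => \int[mu]_x ((f_ n x)%:E * (p x)%:E)))%E.
  apply: congr_lim; apply/funext => n /=.
  have mpre r : measurable (f_ n @^-1` [set r]) by exact: measurable_funPTI.
  have mind r : measurable_fun [set: R] (\1_(f_ n @^-1` [set r]) : R -> R).
    exact: measurable_indic.
  under [LHS]eq_integral do rewrite fimfunE -fsumEFin//.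
  rewrite [LHS]ge0_integral_fsum//; last 2 first.
    - by move=> r; exact/measurable_EFinP/measurableT_comp.
    - by move=> k x _; rewrite EFinM nnfun_muleindic_ge0.
  under [RHS]eq_integral.
    move=> x xD; rewrite fimfunE -fsumEFin// muleC ge0_mule_fsumr; last first.
      by move=> r; rewrite EFinM nnfun_muleindic_ge0.
    over.
  rewrite [RHS]ge0_integral_fsum//; last 2 first.
    - move=> r; apply: emeasurable_funM => //.
      by apply/measurable_EFinP; apply: measurable_funM => //; exact: mind.
    - by move=> k x _; rewrite mule_ge0 ?lee_fin// -lee_fin EFinM nnfun_muleindic_ge0.
  apply: eq_fsbigr => r _.
  rewrite integralZl_indic_nnsfun//= integral_indic// setIT nuE//.
  rewrite [RHS](_ : _ = \int[mu]_x (r%:E * ((\1_(f_ n @^-1` [set r]) x)%:E * (p x)%:E)))%E; last first.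
    by apply: eq_integral => x _; rewrite EFinM muleC -muleA.
  have mD : measurable_fun [set: R] (fun x => ((\1_(f_ n @^-1` [set r]) x)%:E * (p x)%:E))%E.
    by apply: emeasurable_funM => //; exact/measurable_EFinP.
  rewrite (_ : \int[mu]_(x in _) _ = \int[mu]_x ((\1_(f_ n @^-1` [set r]) x)%:E * (p x)%:E))%E; last first.
    rewrite integral_mkcond; apply: eq_integral => x _.
    by rewrite patchE indicE; case: ifP => _; rewrite ?mul1e ?mul0e.
  (* A negative [r] is not a value of the approximation, so its preimage is empty and both sides
     vanish. *)
  have [r0|r0] := leP 0 r.
    rewrite ge0_integralZl//.
    by move=> x _; rewrite mule_ge0// lee_fin.
  rewrite preimage_nnfun0//.
  under eq_integral do rewrite indic0 mul0e.
  under [RHS]eq_integral do rewrite indic0 mul0e mule0.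
  by rewrite integral0 mule0.
rewrite -monotone_convergence//=.
- apply: eq_integral => x _; apply/cvg_lim => //.
  by apply: cvgeZr => //; exact: cvg_nnsfun_approx.
- by move=> n; exact: emeasurable_funM (mf_ n) mpE.
- by move=> n ? _; rewrite mule_ge0// lee_fin.
- by move=> x _ i j ij; rewrite lee_wpmul2r ?lee_fin//; exact: ndf_.
Qed.

(** Distribution function of an unnormalized density: positivity of [u] makes it strictly
    increasing, hence the strict bounds, and the last two clauses are its limits at both ends. This
    is the form in which [prekopa_leindler1] consumes densities. *)
Lemma primitive_density (u : R -> R) : continuous u -> (forall x, 0 < u x) ->
  mu.-integrable setT (EFin \o u) ->
  let U := (\int[mu]_x u x)%R in
  exists F : R -> R, [/\ (forall x : R, is_derive x 1 F (u x)),
    (forall x, 0 < F x < U),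
    (forall e, 0 < e -> exists x, F x < e) &
    (forall e, 0 < e -> exists x, U - e < F x)].
Proof.
move=> cu u0 iu U.
pose F (x : R) : R := (\int[mu]_(t in [set` `]-oo, x]]) u t)%R.
have iuS A : measurable A -> mu.-integrable A (EFin \o u).
  by move=> mA; exact: integrableS iu.
have mu' : measurable_fun [set: R] (fun x => (u x)%:E) by case/integrableP : iu.
have dF (x : R) : is_derive x 1 F (u x).
  have /= [] := @continuous_FTC1 _ u -oo%O x (x + 1) _ _ _ (cu x).
  - by rewrite ltrDl.
  - exact: iuS.
  - by rewrite ltNyr.
  - by move=> dF <-; rewrite derive1E; exact: derivableP.
have FE x : (F x)%:E = (\int[mu]_(t in `]-oo, x]) (u t)%:E)%E.
  rewrite /F /Rintegral fineK//; apply: integrable_fin_num => //; exact: iuS.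
have UE : U%:E = (\int[mu]_t (u t)%:E)%E.
  rewrite /U /Rintegral fineK//; exact: integrable_fin_num.
have F0 x : 0 <= F x.
  by rewrite -lee_fin FE integral_ge0// => y _; rewrite lee_fin ltW.
have FU x : F x <= U.
  rewrite -lee_fin FE UE; apply: ge0_subset_integral => //= y _.
  by rewrite lee_fin ltW.
have Finc : {homo F : x y / x < y}.
  move=> x y xy; apply: (@gtr0_derive1_incr _ F x y) => //.
  - by move=> z _; rewrite derive1E derive_val.
  - by apply: derivable_within_continuous => z _.
exists F; split => //.
- move=> x; rewrite (le_lt_trans (F0 (x - 1)))//=; last by apply: Finc; rewrite ltrBlDr ltrDl.
  by rewrite (lt_le_trans _ (FU (x + 1)))// Finc// ltrDl.
- move=> e e0.
  (* The mass to the right of [- n] increases to [U], so [F (- n)] tends to 0. *)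
  have h : (\int[mu]_(t in `](- n%:R)%R, +oo[) (u t)%:E @[n --> \oo] --> U%:E)%E.
    rewrite UE (_ : setT = \bigcup_n [set` `](- n%:R)%R, +oo[]) //.
      apply: ge0_nondecreasing_set_cvg_integral => //.
      - move=> m n mn; apply/subsetPset => x /=; rewrite !in_itv/= !andbT.
        by apply: le_lt_trans; rewrite lerN2 ler_nat.
      - by move=> i; exact: measurable_funTS.
      - by move=> i x _; rewrite lee_fin ltW.
    apply/esym; rewrite -subTset => x _; exists (Num.truncn `|x|).+1 => //=.
    rewrite in_itv/= andbT ltrNl (le_lt_trans (ler_norm _))// normrN.
    by rewrite truncnS_gt.
  have hF n : (\int[mu]_(t in `](- n%:R)%R, +oo[) (u t)%:E = (U - F (- n%:R))%:E)%E.
    rewrite EFinB UE FE.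
    rewrite -(setUv `]-oo, (- n%:R)%R]%classic) setCitvl.
    rewrite integral_setU//=.
    - by rewrite -FE addrAC subee// add0e.
    - exact: measurable_funTS.
    - by apply/disj_setPS => x /= []; rewrite !in_itv/= andbT leNgt => /negP.
  move: h; under eq_fun do rewrite hF.
  move/fine_cvgP => [_] /cvgrPdist_lt /(_ e e0)[N _ /(_ N (leqnn N))]/= h.
  exists (- N%:R); move: h; rewrite opprB addrC subrK => /(le_lt_trans _); apply.
  exact: ler_norm.
- move=> e e0.
  have h : (\int[mu]_(t in `]-oo, n%:R]) (u t)%:E @[n --> \oo] --> U%:E)%E.
    rewrite UE (_ : setT = \bigcup_n [set` `]-oo, n%:R]]) //.
      apply: ge0_nondecreasing_set_cvg_integral => //.
      - move=> m n mn; apply/subsetPset => x /=; rewrite !in_itv/=.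
        by move/le_trans; apply; rewrite ler_nat.
      - by move=> i; exact: measurable_funTS.
      - by move=> i x _; rewrite lee_fin ltW.
    apply/esym; rewrite -subTset => x _; exists (Num.truncn `|x|).+1 => //=.
    by rewrite in_itv/= ltW// (le_lt_trans (ler_norm _))// truncnS_gt.
  move: h; under eq_fun do rewrite -FE.
  move/fine_cvgP => [_] /cvgrPdist_lt /(_ e e0)[N _ /(_ N (leqnn N))]/= h.
  exists N%:R; rewrite ltrBlDr addrC -ltrBlDr (le_lt_trans _ h)//.
  exact: ler_norm.
Qed.

End densities.

Section jensen.
Context d (T : measurableType d) {R : realType} (P : probability T R).

(** Jensen's inequality by integrating the tangent bound [expR h >= expR m * (1 + (h - m))]; an
    infinite right-hand side is set aside first so that this integration is legitimate. *)
Lemma expR_integral_le (h : T -> R) : P.-integrable setT (EFin \o h) ->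
  ((expR (fine (\int[P]_x (h x)%:E)))%:E <= \int[P]_x (expR (h x))%:E)%E.
Proof.
move=> ih; set m := fine _.
have mh : measurable_fun setT h by apply/measurable_EFinP; case/integrableP : ih.
have mE : (m%:E = \int[P]_x (h x)%:E)%E.
  by rewrite fineK//; exact: (integrable_fin_num measurableT ih).
have meh : measurable_fun setT (fun x => expR (h x)) by exact: measurableT_comp.
have eh0 : (0 <= \int[P]_x (expR (h x))%:E)%E.
  by apply: integral_ge0 => x _; rewrite lee_fin expR_ge0.
have [->|fin] := eqVneq (\int[P]_x (expR (h x))%:E)%E +oo%E; first exact: leey.
have ieh : P.-integrable setT (fun x => (expR (h x))%:E).
  apply/integrableP; split; first exact/measurable_EFinP.
  under eq_integral do rewrite gee0_abs ?lee_fin ?expR_ge0//.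
  by rewrite ltey.
have icst (c : R) : P.-integrable setT (EFin \o cst c).
  exact: finite_measure_integrable_cst.
have ihm : P.-integrable setT (fun x => (h x - m)%:E).
  by under eq_fun do rewrite EFinB; exact: (integrableB measurableT ih (icst m)).
have i1 : P.-integrable setT (fun x => (1 + (h x - m))%:E).
  by under eq_fun do rewrite EFinD; exact: (integrableD measurableT (icst 1) ihm).
have -> : ((expR m)%:E = \int[P]_x ((expR m)%:E * (1 + (h x - m))%:E))%E.
  rewrite integralZl//; under [X in (_ * X)%E]eq_integral do rewrite EFinD.
  rewrite integralD//; last exact: (icst 1).
  under [X in (_ * (_ + X))%E]eq_integral do rewrite EFinB.
  rewrite integralB//; last exact: (icst m).
  rewrite -mE !integral_cst//= probability_setT !mule1 -EFinB subrr adde0.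
  by rewrite mule1.
apply: le_integral => //; first exact: integrableZl.
move=> x _; rewrite -EFinM lee_fin.
rewrite (_ : expR (h x) = expR m * expR (h x - m)); last first.
  by rewrite -expRD addrC subrK.
by rewrite ler_wpM2l ?expR_ge0// expR_ge1Dx.
Qed.

End jensen.

(** * The standard normal law: density, mean, absolute first moment *)

Section standard_gaussian.
Context {R : realType}.
Local Notation mu := (@lebesgue_measure R).
Variable gauss : probability R R.
Hypothesis gaussE : forall A, measurable A -> gauss A = normal_prob (0 : R) 1 A.
Local Notation phi := (normal_pdf (0 : R) 1).
Local Notation lp := (ln (normal_peak (1 : R))).

(** With the normalization moved into the exponent, products with exponentials become sums of
    exponents, as Prekopa-Leindler requires. *)
Lemma std_pdfE x : phi x = expR (lp - x ^+ 2 / 2).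
Proof.
rewrite normal_pdfE ?oner_neq0// expRD lnK ?posrE; last first.
  by rewrite normal_peak_gt0// oner_neq0.
by rewrite /normal_fun subr0 expr1n mulNr.
Qed.

Lemma ge0_integral_gauss (f : R -> \bar R) : measurable_fun [set: R] f ->
  (forall x, 0 <= f x)%E -> (\int[gauss]_x f x = \int[mu]_x (f x * (phi x)%:E))%E.
Proof.
move=> mf f0; apply: ge0_integral_density => //.
- by move=> x; exact: normal_pdf_ge0.
- exact: measurable_normal_pdf.
Qed.

Lemma std_peakE : normal_peak (1 : R) = (Num.sqrt (2 * pi))^-1.
Proof. by rewrite /normal_peak expr1n mul1r mulr_natl. Qed.

Lemma is_derive_std_pdf (x : R) : is_derive x 1 (fun y => - phi y) (x * phi x).
Proof.
under eq_fun do rewrite std_pdfE.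
rewrite std_pdfE.
have h : is_derive x 1 (fun y : R => lp - y ^+ 2 / 2) (- x).
  have -> : (fun y : R => lp - y ^+ 2 / 2) =
     cst lp - (2^-1 \*: (fun y : R => y ^+ 2)).
    by apply/funext => y /=; rewrite mulrC.
  apply: is_derive_eq.
  by rewrite /GRing.scale/=; lra.
have h' := @is_derive1_comp R expR (fun y => lp - y ^+ 2 / 2) x _ _ (is_derive_expR _) h.
have -> : (fun y => - expR (lp - y ^+ 2 / 2)) =
   - (expR \o (fun y => lp - y ^+ 2 / 2)) by [].
apply: is_derive_eq; ring.
Qed.

Lemma cvg_std_pdf : phi x @[x --> +oo] --> (0 : R).
Proof.
(* The bound by [x^-1] comes from [expR (x ^+ 2 / 2) >= 1 + x ^+ 2 / 2 >= x]. *)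
apply: (@squeeze_cvgr _ _ _ _ (cst 0) (fun x => normal_peak 1 * x^-1)).
- near=> x.
  rewrite normal_pdf_ge0/= std_pdfE expRD lnK ?posrE ?normal_peak_gt0 ?oner_neq0//.
  rewrite ler_wpM2l ?normal_peak_ge0//.
  rewrite expRN lef_pV2 ?posrE ?expR_gt0//.
  apply: le_trans (expR_ge1Dx _).
  by have := sqr_ge0 (x - 1); rewrite sqrrB; lra.
- exact: cvg_cst.
- rewrite -[X in _ --> X](mulr0 (normal_peak 1)).
  apply: cvgMr; apply/gtr0_cvgV0 => //.
  by near=> x.
Unshelve. all: by end_near. Qed.

Lemma continuous_std_pdf : continuous phi.
Proof. by apply: continuous_normal_pdf; rewrite oner_neq0. Qed.

Lemma continuous_id_std_pdf : continuous (fun x : R => x * phi x).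
Proof. by move=> x; apply: cvgM => //; exact: continuous_std_pdf. Qed.

Lemma integral_id_std_pdf :
  (\int[mu]_(x in `[0%R, +oo[) (x * phi x)%:E = (normal_peak 1)%:E)%E.
Proof.
have p0 : phi 0 = normal_peak 1.
  by rewrite std_pdfE expr0n/= mul0r subr0 lnK// posrE normal_peak_gt0 ?oner_neq0.
rewrite (@ge0_continuous_FTC2y _ _ (fun y => - phi y) 0 0).
- by rewrite p0 sub0e EFinN oppeK.
- by move=> x x0; rewrite mulr_ge0// normal_pdf_ge0.
- by apply: continuous_subspaceT; exact: continuous_id_std_pdf.
- rewrite -[X in _ --> X]oppr0; apply: cvgN; exact: cvg_std_pdf.
- by move=> x _; have [] := is_derive_std_pdf x.
- by apply: cvg_at_right_filter; apply: cvgN; exact: continuous_std_pdf.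
- by move=> x _; rewrite derive1E; have [_ ->] := is_derive_std_pdf x.
Qed.

Lemma integral_gauss_pos : (\int[gauss]_x (Num.max x 0)%:E = (normal_peak 1)%:E)%E.
Proof.
rewrite ge0_integral_gauss; first last.
- by move=> x; rewrite lee_fin le_max lexx orbT.
- by apply/measurable_EFinP; exact: measurable_maxr.
rewrite -integral_id_std_pdf [RHS]integral_mkcond.
apply: eq_integral => x _; rewrite patchE mem_setE in_itv/= andbT -EFinM.
by have [x0|x0] := leP 0 x; rewrite ?mul0r.
Qed.

Lemma integral_gauss_neg : (\int[gauss]_x (Num.max (- x) 0)%:E = (normal_peak 1)%:E)%E.
Proof.
rewrite ge0_integral_gauss; first last.
- by move=> x; rewrite lee_fin le_max lexx orbT.
- by apply/measurable_EFinP; apply: measurable_maxr => //; exact: measurableT_comp.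
rewrite -integral_id_std_pdf.
rewrite (_ : (\int[mu]_(x in `[0%R, +oo[) _)%E =
  (\int[mu]_(x in `[0%R, +oo[) (((fun x => - x * phi x) \o -%R) x)%:E)%E); last first.
  by apply: eq_integral => x _ /=; rewrite opprK !std_pdfE sqrrN.
rewrite -ge0_integration_by_substitutionNy; first last.
- move=> x; rewrite in_itv/= oppr0 => x0.
  by rewrite mulr_ge0 ?normal_pdf_ge0// oppr_ge0 ltW.
- apply: continuous_subspaceT => x.
  by apply: cvgM; [exact: cvgN|exact: continuous_std_pdf].
rewrite oppr0 [RHS]integral_mkcond.
apply: eq_integral => x _; rewrite patchE mem_setE in_itv/= -EFinM.
rewrite -oppr_ge0.
by have [x0|x0] := leP 0 (- x); rewrite ?mul0r.
Qed.

Lemma normr_posneg (x : R) : `|x| = Num.max x 0 + Num.max (- x) 0.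
Proof.
have [x0|x0] := leP 0 x; first by rewrite ger0_norm// max_r ?addr0// oppr_le0.
by rewrite ltr0_norm// max_l ?add0r// oppr_ge0 ltW.
Qed.

Lemma integrable_gauss_id : gauss.-integrable setT (fun x => x%:E).
Proof.
apply/integrableP; split; first exact/measurable_EFinP.
rewrite (_ : (\int[gauss]_x _)%E =
  (\int[gauss]_x ((Num.max x 0)%:E + (Num.max (- x) 0)%:E))%E); last first.
  by apply: eq_integral => x _; rewrite -EFinD -normr_posneg.
rewrite ge0_integralD//; first by rewrite integral_gauss_pos integral_gauss_neg ltry.
- by move=> x _; rewrite lee_fin le_max lexx orbT.
- by apply/measurable_EFinP; exact: measurable_maxr.
- by move=> x _; rewrite lee_fin le_max lexx orbT.
- by apply/measurable_EFinP; apply: measurable_maxr => //; exact: measurableT_comp.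
Qed.

Lemma integral_gauss_abs :
  (\int[gauss]_x `|x|%:E = (Num.sqrt 2 / Num.sqrt pi)%:E)%E.
Proof.
rewrite (_ : (\int[gauss]_x _)%E =
  (\int[gauss]_x ((Num.max x 0)%:E + (Num.max (- x) 0)%:E))%E); last first.
  by apply: eq_integral => x _; rewrite -EFinD -normr_posneg.
rewrite ge0_integralD//; first last.
- by apply/measurable_EFinP; apply: measurable_maxr => //; exact: measurableT_comp.
- by move=> x _; rewrite lee_fin le_max lexx orbT.
- by apply/measurable_EFinP; exact: measurable_maxr.
- by move=> x _; rewrite lee_fin le_max lexx orbT.
rewrite integral_gauss_pos integral_gauss_neg std_peakE -EFinD; congr EFin.
rewrite sqrtrM// invfM -mulrDl; congr (_ * _).
rewrite -[RHS](@mulfK _ (Num.sqrt 2)) ?gt_eqF ?sqrtr_gt0//.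
by rewrite -expr2 sqr_sqrtr// mulr2n mulrDl mul1r.
Qed.

Lemma integral_gauss_id : (\int[gauss]_x x%:E = 0)%E.
Proof.
rewrite integralE.
rewrite (_ : (\int[gauss]_x _^\+ x)%E = (\int[gauss]_x (Num.max x 0)%:E)%E); last first.
  by apply: eq_integral => x _; rewrite funeposE -EFin_max.
rewrite (_ : (\int[gauss]_x _^\- x)%E = (\int[gauss]_x (Num.max (- x) 0)%:E)%E); last first.
  by apply: eq_integral => x _; rewrite funenegE -EFin_max.
by rewrite integral_gauss_pos integral_gauss_neg subee.
Qed.

End standard_gaussian.

(** * The quadratic transport inequality for the standard normal law *)

Section gaussian_transport.
Context {R : realType}.
Local Notation mu := (@lebesgue_measure R).
Variable gauss : probability R R.
Hypothesis gaussE : forall A, measurable A -> gauss A = normal_prob (0 : R) 1 A.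
Local Notation phi := (normal_pdf (0 : R) 1).
Local Notation lp := (ln (normal_peak (1 : R))).

(** Domination by [K] times the normal density of variance [v], where [K] cancels the normalization
    of that density. *)
Lemma integrable_gauss_dominated (a : R -> R) (k v : R) : 0 < v ->
  continuous a -> (forall x, a x <= k - x ^+ 2 / (2 * v)) ->
  mu.-integrable [set: R] (fun x => (expR (a x))%:E).
Proof.
move=> v0 ca ak.
have sv0 : Num.sqrt v != 0 by rewrite gt_eqF// sqrtr_gt0.
pose K := expR k / normal_peak (Num.sqrt v).
have := integrableZl measurableT K (@integrable_normal_pdf R 0 (Num.sqrt v)).
apply: le_integrable => //.
  apply/measurable_EFinP; apply: measurableT_comp => //.
  exact: continuous_measurable_fun.
move=> x _; rewrite -EFinM !abse_EFin lee_fin ger0_norm ?expR_ge0//.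
apply: le_trans (ler_norm _); rewrite normal_pdfE// mulrA /K divfK; last first.
  by rewrite gt_eqF// normal_peak_gt0.
rewrite /normal_fun subr0 -expRD ler_expR (le_trans (ak x))//.
by rewrite sqr_sqrtr ?(ltW v0)// mulNr mulr_natl.
Qed.

Lemma gauss_transport v (f g : R -> R) : 1 < v -> continuous f -> continuous g ->
  gauss.-integrable setT (EFin \o f) ->
  (forall x y, g x <= f y + (x - y) ^+ 2 / (2 * v)) ->
  (\int[gauss]_x (expR (g x))%:E <= (expR (fine (\int[gauss]_x (f x)%:E)))%:E)%E.
Proof.
move=> v1 cf cg intf gf; set m := fine _.
have v0 : 0 < v by rewrite (lt_trans _ v1).
have vn0 : v != 0 by rewrite gt_eqF.
(* Prekopa-Leindler is applied to [e^(- (v - 1) f)] with weight [1/v] and to [e^g]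
   with weight [1 - 1/v]; Jensen bounds the first integral from below. *)
pose s := 1 - v^-1; pose r := v - 1.
have s01 : 0 < s < 1.
  by rewrite subr_gt0 invf_lt1// v1/= ltrBlDr ltrDl invr_gt0.
(* This balance turns Jensen's bound [- (r * m)], weighted by [1 - s], into [- (s * m)], so that the
   factor [s] cancels at the end. *)
have s1r : (1 - s) * r = s by rewrite /s /r; field.
pose a x := - (r * f x) + (lp - x ^+ 2 / 2).
pose b x := g x + (lp - x ^+ 2 / 2).
have cphi : continuous (fun x : R => lp - x ^+ 2 / 2).
  move=> x; apply: cvgB; first exact: cvg_cst.
  by apply: cvgM; [exact: exprn_continuous|exact: cvg_cst].
have ca : continuous a.
  move=> x; apply: cvgD; last exact: cphi.
  by apply: cvgN; apply: cvgM; [exact: cvg_cst|exact: cf].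
have cb : continuous b by move=> x; apply: cvgD; [exact: cg|exact: cphi].
(* The hypothesis at [(0, x)] bounds [f] below by a quadratic; multiplied by [r] it uses up all of
   [x ^+ 2 / 2] except [x ^+ 2 / (2 * v)]. *)
have ia : mu.-integrable [set: R] (fun x => (expR (a x))%:E).
  apply: (@integrable_gauss_dominated a (lp - r * g 0) v) => // x.
  rewrite /a.
  have r0 : 0 <= r by rewrite subr_ge0 ltW.
  have := ler_wpM2l r0 (gf 0 x); rewrite sub0r sqrrN mulrDr.
  have -> : r * (x ^+ 2 / (2 * v)) = x ^+ 2 / 2 - x ^+ 2 / (2 * v).
    by rewrite /r; field.
  lra.
(* The hypothesis at [(x, 0)] lets [g] grow like [x ^+ 2 / (2 * v)]; as [1 < v], a Gaussian of
   finite variance [v / (v - 1)] remains. *)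
have ib : mu.-integrable [set: R] (fun x => (expR (b x))%:E).
  apply: (@integrable_gauss_dominated b (lp + f 0) (v / (v - 1))) => //.
    by rewrite divr_gt0// subr_gt0.
  move=> x; rewrite /b; have := gf x 0; rewrite subr0.
  have -> : x ^+ 2 / (2 * (v / (v - 1))) = x ^+ 2 / 2 - x ^+ 2 / (2 * v).
    by field; rewrite vn0 gt_eqF// subr_gt0.
  lra.
have ip : mu.-integrable [set: R] (fun x => (phi x)%:E).
  exact: integrable_normal_pdf.
have cea : continuous (fun x => expR (a x)).
  by move=> x; apply: continuous_comp; [exact: ca|exact: continuous_expR].
have ceb : continuous (fun x => expR (b x)).
  by move=> x; apply: continuous_comp; [exact: cb|exact: continuous_expR].
have [F [dF F0 Fe FU]] := primitive_density cea (fun x => expR_gt0 _) ia.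
have [G [dG G0 Ge GV]] := primitive_density ceb (fun x => expR_gt0 _) ib.
have phi_gt0 x : 0 < phi x by rewrite std_pdfE expR_gt0.
have [W [dW W0 _ _]] := primitive_density (@continuous_std_pdf R) phi_gt0 ip.
set U := (\int[mu]_x expR (a x))%R in F0 FU.
set V := (\int[mu]_x expR (b x))%R in G0 GV.
have U0 : 0 < U by have /andP[h1 h2] := F0 0; exact: lt_trans h1 h2.
have V0 : 0 < V by have /andP[h1 h2] := G0 0; exact: lt_trans h1 h2.
have Un0 : U != 0 by rewrite gt_eqF.
have Vn0 : V != 0 by rewrite gt_eqF.
have W01 x : 0 <= W x <= 1.
  have := W0 x; rewrite /Rintegral (_ : (\int[mu]_x _)%E = 1%:E).
    by move=> /andP[/ltW -> /ltW].
  exact: integral_normal_pdf.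
have scale (H h : R -> R) (x c : R) : is_derive x 1 H (expR (h x)) -> 0 < c ->
    is_derive x 1 (fun y => H y / c) (expR (h x - ln c)).
  move=> dH c0; have -> : (fun y => H y / c) = c^-1 \*: H.
    by apply/funext => y; rewrite mulrC.
  apply: is_derive_eq.
  by rewrite expRD expRN lnK ?posrE// /GRing.scale/= mulrC.
(* Dividing by the masses turns both densities into probability densities; the constant [c] becomes
   [U^(1 - s) V^s], written through logarithms. *)
have c1 : expR ((1 - s) * ln U + s * ln V) <= 1.
  apply: (@prekopa_leindler1 R (fun x => F x / U) (fun x => G x / V) W
     (fun x => a x - ln U) (fun x => b x - ln V) phi s _ s01) => //.
  - by move=> x; exact: scale.
  - by move=> x; exact: scale.
  - move=> x.
    have /andP[FUx0 FUx1] : 0 < F x / U < 1.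
      by rewrite divr_gt0//= ?ltr_pdivrMr ?mul1r//; have /andP[] := F0 x.
    have [y1 y1lt] : exists y, G y < F x / U * V.
      by apply: Ge; rewrite mulr_gt0.
    have [y2 y2gt] : exists y, F x / U * V < G y.
      have [|y] := GV (V * (1 - F x / U)).
        by rewrite mulr_gt0// subr_gt0.
      by rewrite mulrBr opprB mulr1 addrC subrK mulrC; exists y.
    have Gnd : {homo G : x y / x <= y}.
      by apply: is_derive_ge0_homo dG _ => y; exact: expR_ge0.
    have y12 : y1 <= y2.
      rewrite leNgt; apply/negP => /ltW /Gnd; rewrite leNgt => /negP; apply.
      exact: lt_trans y1lt y2gt.
    have [||y _ yE] := @IVT R G y1 y2 (F x / U * V) y12.
    + apply: derivable_within_continuous => y _; by have [] := dG y.
    + by rewrite ge_min (ltW y1lt)/= le_max (ltW y2gt) orbT.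
    by exists y; rewrite yE mulfK.
  (* Each end of the distribution function contributes half of [e]. *)
  - move=> e e0.
    have [|x Fx] := Fe (e / 2 * U); first by rewrite mulr_gt0// divr_gt0.
    have [|y Fy] := FU (e / 2 * U); first by rewrite mulr_gt0// divr_gt0.
    exists x, y; rewrite -mulrBl ltr_pdivlMr//; lra.
  - by move=> x; rewrite normal_pdf_ge0.
  - move=> x y; rewrite -expRD std_pdfE ler_expR.
    have := gf y x.
    have /andP[s0 s1] := s01.
    move=> /(ler_wpM2l (ltW s0)).
    have -> : (1 - s) * ln U + s * ln V + ((1 - s) * (a x - ln U) + s * (b y - ln V))
      = (1 - s) * a x + s * b y by ring.
    have -> : (1 - s) * a x + s * b y =
      - (((1 - s) * r) * f x) + s * g y + (lp - ((1 - s) * x ^+ 2 + s * y ^+ 2) / 2).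
      by rewrite /a /b; ring.
    rewrite s1r.
    have -> : s * (f x + (y - x) ^+ 2 / (2 * v)) =
       s * f x + s * (1 - s) * (y - x) ^+ 2 / 2.
      by rewrite /s; field.
    (* The convexity defect of the square equals the transport cost exactly, because
       [1 - s = v^-1]. *)
    have -> : ((1 - s) * x + s * y) ^+ 2 =
      (1 - s) * x ^+ 2 + s * y ^+ 2 - s * (1 - s) * (y - x) ^+ 2 by ring.
    lra.
have mf : measurable_fun [set: R] f by exact: continuous_measurable_fun.
have mg : measurable_fun [set: R] g by exact: continuous_measurable_fun.
have UE : (\int[gauss]_x (expR (- (r * f x)))%:E = U%:E)%E.
  rewrite (ge0_integral_gauss gaussE).
  - rewrite /U /Rintegral fineK; last exact: (integrable_fin_num measurableT ia).
    by apply: eq_integral => x _; rewrite -EFinM std_pdfE -expRD.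
  - apply/measurable_EFinP; apply: measurableT_comp => //.
    apply: measurableT_comp => //; exact: measurable_funM.
  - by move=> x; rewrite lee_fin expR_ge0.
have VE : (\int[gauss]_x (expR (g x))%:E = V%:E)%E.
  rewrite (ge0_integral_gauss gaussE).
  - rewrite /V /Rintegral fineK; last exact: (integrable_fin_num measurableT ib).
    by apply: eq_integral => x _; rewrite -EFinM std_pdfE -expRD.
  - by apply/measurable_EFinP; apply: measurableT_comp.
  - by move=> x; rewrite lee_fin expR_ge0.
have Um : expR (- (r * m)) <= U.
  rewrite -lee_fin -UE.
  have irf : gauss.-integrable setT (EFin \o (fun x => - r * f x)).
    have := integrableZl measurableT (- r) intf.
    by under eq_fun do rewrite -EFinM.
  have := expR_integral_le irf.
  under [X in (_ <= X)%E -> _]eq_integral do rewrite mulNr.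
  apply: le_trans; rewrite lee_fin ler_expR.
  under eq_integral do rewrite EFinM.
  by rewrite integralZl// fineM ?mulNr//; exact: (integrable_fin_num measurableT intf).
rewrite VE lee_fin -(@lnK _ V) ?posrE// ler_expR.
have lnU : - (r * m) <= ln U by rewrite -(expRK (- (r * m))) ler_ln ?posrE ?expR_gt0.
have : (1 - s) * ln U + s * ln V <= 0 by rewrite -expR_le1.
have /andP[s0 s1] := s01.
have s1' : 0 <= 1 - s by rewrite subr_ge0 ltW.
have := ler_wpM2l s1' lnU.
have -> : (1 - s) * - (r * m) = - (s * m) by rewrite -[in RHS]s1r; ring.
move=> h1 h2; rewrite -(ler_pM2l s0); lra.
Qed.

End gaussian_transport.

Definition mfun_of d (T : measurableType d) d1 (T1 : measurableType d1)
    (X : T -> T1) (mX : measurable_fun setT X) : {mfun T >-> T1} :=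
  HB.pack_for {mfun T >-> T1} X (isMeasurableFun.Build _ _ _ _ X mX).

(** * Integration over independent pairs *)

Section independent_pairs.
Context d (T : measurableType d) {R : realType} (P : probability T R).
Context d1 (T1 : measurableType d1) d2 (T2 : measurableType d2).

(** The two targets may differ, so that a real variable can be independent of a variable with values
    in [R * R]. *)
Definition indep_pair (X : T -> T1) (Y : T -> T2) :=
  forall E F, measurable E -> measurable F ->
  P (X @^-1` E `&` Y @^-1` F) = (P (X @^-1` E) * P (Y @^-1` F))%E.

Variables (X : {mfun T >-> T1}) (Y : {mfun T >-> T2}).
Hypothesis XY : indep_pair X Y.

Let mXY : measurable_fun setT (fun w => (X w, Y w)).
Proof. exact: measurable_fun_pair. Qed.

Let law_pair E : measurable E ->
  (distribution P X \x distribution P Y)%E E = distribution P (mfun_of mXY) E.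
Proof.
move=> mE.
apply: (@product_measure_unique _ _ _ _ _ (distribution P X) (distribution P Y)
  (distribution P (mfun_of mXY))) => // A B mA mB; exact: XY.
Qed.

Lemma ge0_integral_indep_pair (f : T1 * T2 -> \bar R) :
  measurable_fun setT f -> (forall z, 0 <= f z)%E ->
  (\int[P]_w f (X w, Y w) =
   \int[distribution P X]_x \int[distribution P Y]_y f (x, y))%E.
Proof.
move=> mf f0; rewrite -fubini_tonelli1//.
rewrite (eq_measure_integral (distribution P (mfun_of mXY))); last first.
  by move=> A mA _; exact: law_pair.
by rewrite ge0_integral_distribution.
Qed.

Lemma integral_indep_pair (f : T1 * T2 -> \bar R) :
  measurable_fun setT f -> P.-integrable setT (fun w => f (X w, Y w)) ->
  (\int[P]_w f (X w, Y w) =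
   \int[distribution P X]_x \int[distribution P Y]_y f (x, y))%E.
Proof.
move=> mf intf.
have i1 : (distribution P (mfun_of mXY)).-integrable setT f.
  exact: integrable_pushforward.
have ii : (distribution P X \x distribution P Y)%E.-integrable setT f.
  apply/integrableP; split => //; case/integrableP : i1 => _.
  congr (_ < +oo)%E; apply: eq_measure_integral => A mA _.
  exact/esym/law_pair.
have := integral12_prod_meas1 ii; rewrite /fubini_F => ->.
rewrite (eq_measure_integral (distribution P (mfun_of mXY))); last first.
  by move=> A mA _; exact: law_pair.
by rewrite integral_distribution.
Qed.

End independent_pairs.

(** * The dual transport inequality and integration of one variable *)

Section transport_inequality.
Context {R : realType}.

(** The one-sided form gives the bound on [|f x - f y|] by exchanging [x] and [y], and it forces
    [0 <= L]. *)
Definition lipschitz_with (L : R) (f : R -> R) :=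
  forall x y, f x <= f y + L * `|x - y|.

Lemma lipschitz_with_dist L f x y : lipschitz_with L f -> `|f x - f y| <= L * `|x - y|.
Proof.
move=> lf; have := lf x y; have := lf y x; rewrite (distrC y x) ler_norml.
lra.
Qed.

Lemma lipschitz_with_continuous L f : lipschitz_with L f -> continuous f.
Proof.
move=> lf x; apply/cvgrPdist_lt => e e0.
have L0 : 0 <= L.
  have := lipschitz_with_dist 1 0 lf; rewrite subr0 normr1 mulr1.
  exact: le_trans.
near=> y.
rewrite (le_lt_trans (lipschitz_with_dist _ _ lf))//.
rewrite (@le_lt_trans _ _ ((L + 1) * `|x - y|))//.
  by rewrite ler_wpM2r// lerDl.
rewrite mulrC -ltr_pdivlMr ?ltr_wpDl//.
near: y; apply: (@cvgr_dist_lt _ _ _ _ _ id x) => //.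
by rewrite divr_gt0// ltr_wpDl.
Unshelve. all: by end_near. Qed.

Lemma lipschitz_with_measurable L f : lipschitz_with L f -> measurable_fun [set: R] f.
Proof. by move=> /lipschitz_with_continuous; exact: continuous_measurable_fun. Qed.

Lemma lipschitz_with_growth L f x : lipschitz_with L f -> `|f x| <= `|f 0| + L * `|x|.
Proof.
move=> lf; have := lipschitz_with_dist x 0 lf; rewrite subr0 => h.
by rewrite -[X in `|X|](subrK (f 0)) (le_trans (ler_normD _ _))// addrC lerD2l.
Qed.

Lemma lipschitz_with_integrable (nu : probability R R) L f :
  nu.-integrable setT (fun x => x%:E) -> lipschitz_with L f ->
  nu.-integrable setT (EFin \o f).
Proof.
move=> intid lf.
have h : nu.-integrable setT (fun x => (`|f 0| + L * `|x|)%:E).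
  under eq_fun do rewrite EFinD EFinM.
  apply: integrableD => //; first exact: finite_measure_integrable_cst.
  by apply: integrableZl => //; exact: integrable_norm.
apply: le_integrable h => //.
  by apply/measurable_EFinP; exact: lipschitz_with_measurable lf.
move=> x _; rewrite !abse_EFin lee_fin.
by apply: le_trans (lipschitz_with_growth _ lf) (ler_norm _).
Qed.

(* Dual form of Talagrand's quadratic transportation inequality, restricted to
   Lipschitz functions. *)
Definition transport_ineq (nu : probability R R) (V : R) :=
  forall (L : R) (f g : R -> R), lipschitz_with L f -> lipschitz_with L g ->
  (forall x y, g x <= f y + (x - y) ^+ 2 / (2 * V)) ->
  (\int[nu]_x (expR (g x))%:E <= (expR (fine (\int[nu]_x (f x)%:E)))%:E)%E.

Section partial_integration.
Variable nu : probability R R.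
Hypothesis intid : nu.-integrable setT (fun x => x%:E).
Variables (I : Type) (D : I -> I -> R) (L : R) (f g : I -> R -> R).
Hypotheses (lf : forall p, lipschitz_with L (f p))
  (lg : forall p, lipschitz_with L (g p)).
Hypotheses (Df : forall p q y, f p y <= f q y + D p q)
  (Dg : forall p q y, g p y <= g q y + D p q).

(** Tensorization: integrating out one variable replaces [f] by its mean and [g] by the logarithm of
    its exponential mean. The new pair has the same control [D] in the parameter and satisfies the
    comparison with the remaining cost [k], so the step can be repeated. *)
Definition part_mean p := fine (\int[nu]_y (f p y)%:E).
Definition part_log p := ln (fine (\int[nu]_y (expR (g p y))%:E)).

Lemma part_meanE p : (\int[nu]_y (f p y)%:E = (part_mean p)%:E)%E.
Proof.
rewrite fineK//; apply: (integrable_fin_num measurableT).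
exact: lipschitz_with_integrable (lf p).
Qed.

Lemma part_mean_dist p q : part_mean p <= part_mean q + D p q.
Proof.
rewrite -lee_fin -part_meanE EFinD -part_meanE.
have i c : nu.-integrable setT (EFin \o cst c) by exact: finite_measure_integrable_cst.
have iq := lipschitz_with_integrable intid (lf q).
rewrite (_ : (_ + _)%E = (\int[nu]_y ((f q y)%:E + (D p q)%:E))%E); last first.
  rewrite integralD//; last exact: i.
  by rewrite integral_cst//= probability_setT mule1.
apply: le_integral => //.
- exact: (lipschitz_with_integrable intid (lf p)).
- exact: (integrableD measurableT iq (i _)).
- by move=> y _; rewrite -EFinD lee_fin.
Qed.

Variables (V : R) (nuV : transport_ineq nu V) (k : I -> I -> R).
Hypothesis gfk : forall p q x y, g p x <= f q y + k p q + (x - y) ^+ 2 / (2 * V).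

Let gk p q : (\int[nu]_y (expR (g p y))%:E <= (expR (part_mean q + k p q))%:E)%E.
Proof.
have lfk : lipschitz_with L (fun y => f q y + k p q).
  by move=> x y; have := lf q x y; lra.
apply: le_trans (nuV lfk (lg p) (gfk p q)) _.
rewrite lee_fin ler_expR -lee_fin fineK; last first.
  apply: (integrable_fin_num measurableT).
  exact: lipschitz_with_integrable lfk.
under eq_integral do rewrite EFinD.
rewrite integralD//.
- by rewrite integral_cst//= probability_setT mule1 part_meanE EFinD.
- exact: (lipschitz_with_integrable intid (lf q)).
- exact: finite_measure_integrable_cst.
Qed.

Let mg p : measurable_fun [set: R] (fun y => (expR (g p y))%:E).
Proof.
apply/measurable_EFinP; apply: measurableT_comp => //.
exact: lipschitz_with_measurable (lg p).
Qed.

Let ig p : nu.-integrable setT (fun y => (expR (g p y))%:E).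
Proof.
apply/integrableP; split => //.
under eq_integral do rewrite gee0_abs ?lee_fin ?expR_ge0//.
by rewrite (le_lt_trans (gk p p))// ltry.
Qed.

Let g_gt0 p : 0 < fine (\int[nu]_y (expR (g p y))%:E).
Proof.
have h := expR_integral_le (lipschitz_with_integrable intid (lg p)).
apply: lt_le_trans (expR_gt0 _) _.
rewrite -lee_fin fineK; first exact: h.
exact: (integrable_fin_num measurableT (ig p)).
Qed.

Lemma part_logE p : (\int[nu]_y (expR (g p y))%:E = (expR (part_log p))%:E)%E.
Proof.
rewrite lnK ?posrE// fineK//; exact: (integrable_fin_num measurableT (ig p)).
Qed.

Lemma part_log_dist p q : part_log p <= part_log q + D p q.
Proof.
suff : (\int[nu]_y (expR (g p y))%:E <=
        (expR (D p q))%:E * \int[nu]_y (expR (g q y))%:E)%E.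
  rewrite (part_logE p) (part_logE q) -EFinM lee_fin -expRD ler_expR.
  by rewrite addrC.
rewrite -(integralZl measurableT (ig q)).
apply: (le_integral measurableT (ig p)
  (integrableZl measurableT (expR (D p q)) (ig q))).
move=> y _; rewrite -EFinM lee_fin -expRD ler_expR addrC; exact: Dg.
Qed.

Lemma part_log_le p q : part_log p <= part_mean q + k p q.
Proof.
by have := gk p q; rewrite (part_logE p) lee_fin ler_expR.
Qed.

End partial_integration.

End transport_inequality.

Lemma gauss_transport_ineq {R : realType} (gauss : probability R R) (v : R) :
  (forall A, measurable A -> gauss A = normal_prob (0 : R) 1 A) -> 1 < v ->
  transport_ineq gauss v.
Proof.
move=> gaussE v1 L f g lf lg gf.
apply: (gauss_transport gaussE v1) => //.
- exact: lipschitz_with_continuous lf.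
- exact: lipschitz_with_continuous lg.
- by apply: lipschitz_with_integrable lf; exact: integrable_gauss_id.
Qed.

(** * The recursion for the maximum *)

Section max_step.
Context d (T : measurableType d) {R : realType} (P : probability T R).
Variables (X A B : {RV P >-> R}).

Definition pair_rv : {mfun T >-> (R * R)%type} :=
  mfun_of (measurable_fun_pair (measurable_funPT A) (measurable_funPT B)).

Hypotheses (X_AB : indep_pair P X pair_rv) (A_B : indep_pair P A B).
Local Notation muX := (distribution P X).
Local Notation muA := (distribution P A).
Local Notation muB := (distribution P B).

(** The pair formula is applied twice, first to [X] against the pair, then to [A] against [B]. *)
Lemma ge0_integral_indep3 (f : R -> R -> R -> \bar R) :
  measurable_fun [set: R * (R * R)] (fun z => f z.1 z.2.1 z.2.2) ->
  (forall x a b, 0 <= f x a b)%E ->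
  (\int[P]_w f (X w) (A w) (B w) =
   \int[muX]_x \int[muA]_a \int[muB]_b f x a b)%E.
Proof.
move=> mf f0.
rewrite (@ge0_integral_indep_pair _ _ _ P _ _ _ _ X pair_rv X_AB
  (fun z => f z.1 z.2.1 z.2.2))//.
apply: eq_integral => x _.
have mfx : measurable_fun [set: R * R] (fun y => f x y.1 y.2).
  exact: (measurable_fun_pair2 x mf).
rewrite ge0_integral_distribution//=.
by rewrite (@ge0_integral_indep_pair _ _ _ P _ _ _ _ A B A_B (fun z => f x z.1 z.2)).
Qed.

(** Integrability is asked for every fixed [x], because the inner integral is rewritten pointwise in
    [x]. *)
Lemma integral_indep3 (f : R -> R -> R -> \bar R) :
  measurable_fun [set: R * (R * R)] (fun z => f z.1 z.2.1 z.2.2) ->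
  P.-integrable setT (fun w => f (X w) (A w) (B w)) ->
  (forall x, P.-integrable setT (fun w => f x (A w) (B w))) ->
  (\int[P]_w f (X w) (A w) (B w) =
   \int[muX]_x \int[muA]_a \int[muB]_b f x a b)%E.
Proof.
move=> mf intf intfx.
rewrite (@integral_indep_pair _ _ _ P _ _ _ _ X pair_rv X_AB
  (fun z => f z.1 z.2.1 z.2.2))//.
apply: eq_integral => x _.
have mfx : measurable_fun [set: R * R] (fun y => f x y.1 y.2).
  exact: (measurable_fun_pair2 x mf).
rewrite integral_distribution//=; last exact: intfx.
by rewrite (@integral_indep_pair _ _ _ P _ _ _ _ A B A_B (fun z => f x z.1 z.2)).
Qed.

Variables (q : R) (q01 : 0 <= q < 1).
Hypotheses (iX : P.-integrable setT (EFin \o X))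
  (iA : P.-integrable setT (EFin \o A)) (iB : P.-integrable setT (EFin \o B)).

(** The comparison is made at the coordinate where the larger maximum is attained. Having one
    distance rather than the sum of both is what preserves the transport constant. *)
Lemma max_dist_or (s t s' t' : R) :
  `|Num.max s t - Num.max s' t'| <= `|s - s'| \/
  `|Num.max s t - Num.max s' t'| <= `|t - t'|.
Proof.
have [D0|D0] := leP 0 (Num.max s t - Num.max s' t').
- rewrite ger0_norm//; have [st|st] := leP t s; [left|right];
    (apply: le_trans (ler_norm _); rewrite lerD2l lerN2 le_max lexx ?orbT//).
- rewrite ltr0_norm// opprB !(distrC _ s') !(distrC _ t').
  have [st|st] := leP t' s'; [left|right];
    (apply: le_trans (ler_norm _); rewrite lerD2l lerN2 le_max lexx ?orbT//).
Qed.

Definition max_comb (x a b : R) := Num.max (x + q * a) (- x + q * b).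

(** The factor [q < 1] is dropped: this crude bound serves Lipschitz and integrability claims, while
    the constants come from the quadratic estimate in [transport_ineq_max]. *)
Lemma max_comb_dist x a b x' a' b' :
  max_comb x a b <= max_comb x' a' b' + (`|x - x'| + `|a - a'| + `|b - b'|).
Proof.
have /andP[q0 q1] := q01.
have ha : q * (a - a') <= `|a - a'|.
  apply: le_trans (ler_norm _) _; rewrite normrM ger0_norm//.
  by rewrite ler_piMl// ltW.
have hb : q * (b - b') <= `|b - b'|.
  apply: le_trans (ler_norm _) _; rewrite normrM ger0_norm//.
  by rewrite ler_piMl// ltW.
have := ler_norm (x - x'); have := ler_norm (x' - x); rewrite distrC.
have := normr_ge0 (a - a'); have := normr_ge0 (b - b').
rewrite ge_max -!lerBlDr !le_max; move: ha hb; rewrite !mulrBr => *.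
by apply/andP; split; apply/orP; [left|right]; lra.
Qed.

Lemma measurable_max_comb :
  measurable_fun [set: R * (R * R)] (fun z => max_comb z.1 z.2.1 z.2.2).
Proof.
have m1 : measurable_fun [set: R * (R * R)] (fun z => z.1) by exact: measurable_fst.
have m2 : measurable_fun [set: R * (R * R)] (fun z => z.2.1).
  by apply: measurableT_comp; [exact: measurable_fst|exact: measurable_snd].
have m3 : measurable_fun [set: R * (R * R)] (fun z => z.2.2).
  by apply: measurableT_comp; [exact: measurable_snd|exact: measurable_snd].
apply: measurable_maxr; apply: measurable_funD => //.
- exact: measurable_funM.
- exact: measurableT_comp.
- exact: measurable_funM.
Qed.

Lemma measurable_max_comb_rv :
  measurable_fun [set: T] (fun w => max_comb (X w) (A w) (B w)).
Proof.
have := measurableT_comp measurable_max_comb (measurable_fun_pair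
  (measurable_funPT X) (measurable_funPT pair_rv)).
by [].
Qed.

Definition max_rv : {RV P >-> R} := mfun_of measurable_max_comb_rv.

(** Linear growth in [|x|], [|a|] and [|b|] dominates both integrands; the version with fixed [x]
    feeds [integral_indep3]. *)
Lemma integrable_max_lipschitz L f : lipschitz_with L f ->
  P.-integrable setT (fun w => (f (max_comb (X w) (A w) (B w)))%:E) /\
  forall x, P.-integrable setT (fun w => (f (max_comb x (A w) (B w)))%:E).
Proof.
move=> lf.
have L0 : 0 <= L.
  have := lipschitz_with_dist 1 0 lf; rewrite subr0 normr1 mulr1.
  exact: le_trans.
have /andP[q0 q1] := q01.
have icst (c : R) : P.-integrable setT (EFin \o cst c).
  exact: finite_measure_integrable_cst.
have nX : P.-integrable setT (fun w => (`|X w|)%:E) by exact: (integrable_norm iX).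
have nA : P.-integrable setT (fun w => (`|A w|)%:E) by exact: (integrable_norm iA).
have nB : P.-integrable setT (fun w => (`|B w|)%:E) by exact: (integrable_norm iB).
have mf := lipschitz_with_measurable lf.
have dom x a b : `|f (max_comb x a b)| <= `|f 0| + L * (`|x| + `|a| + `|b|).
  apply: le_trans (lipschitz_with_growth _ lf) _; rewrite lerD2l ler_wpM2l//.
  have := max_comb_dist x a b 0 0 0; have := max_comb_dist 0 0 0 x a b.
  have -> : max_comb 0 0 0 = 0 by rewrite /max_comb !mulr0 oppr0 addr0 maxxx.
  rewrite !subr0 !sub0r !normrN.
  by rewrite ler_norml; lra.
split=> [|x].
- have h : P.-integrable setT (fun w => (`|f 0| + L * (`|X w| + `|A w| + `|B w|))%:E).
    under eq_fun do rewrite EFinD EFinM.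
    apply: integrableD => //; first exact: icst.
    apply: integrableZl => //; under eq_fun do rewrite EFinD EFinD.
    by apply: integrableD => //; exact: integrableD.
  apply: le_integrable h => //.
    apply/measurable_EFinP; apply: measurableT_comp => //.
    exact: measurable_max_comb_rv.
  by move=> w _; rewrite !abse_EFin lee_fin; exact: le_trans (dom _ _ _) (ler_norm _).
- have h : P.-integrable setT (fun w => (`|f 0| + L * (`|x| + `|A w| + `|B w|))%:E).
    under eq_fun do rewrite EFinD EFinM.
    apply: integrableD => //; first exact: icst.
    apply: integrableZl => //; under eq_fun do rewrite EFinD EFinD.
    apply: integrableD => //; apply: integrableD => //; exact: icst.
  apply: le_integrable h => //.
    apply/measurable_EFinP; apply: measurableT_comp => //.
    have := measurableT_comp measurable_max_comb (measurable_fun_pair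
      (measurable_cst x) (measurable_funPT pair_rv)).
    by [].
  by move=> w _; rewrite !abse_EFin lee_fin; exact: le_trans (dom _ _ _) (ler_norm _).
Qed.

Let intid (Y : {RV P >-> R}) : P.-integrable setT (EFin \o Y) ->
  (distribution P Y).-integrable setT (fun x => x%:E).
Proof.
by move=> iY; apply: integrable_pushforward => //; exact/measurable_EFinP.
Qed.

Lemma integrable_max_rv : P.-integrable setT (EFin \o max_rv).
Proof.
have := (@integrable_max_lipschitz 1 id _).1; apply.
by move=> x y; rewrite mul1r -lerBlDl ler_norm.
Qed.

(** The variables are integrated out in the order [b], [a], [x], each with its own transport
    inequality. The value of [V] solves [V = v + q ^+ 2 * V], the Cauchy-Schwarz weight of one node
    followed by one subtree. *)
Lemma transport_ineq_max (v V : R) : 0 < v -> V = v / (1 - q ^+ 2) ->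
  transport_ineq muX v -> transport_ineq muA V -> transport_ineq muB V ->
  transport_ineq (distribution P max_rv) V.
Proof.
move=> v0 VE tX tA tB L f g lf lg gf.
have /andP[q0 q1] := q01.
have q2 : 0 < 1 - q ^+ 2 by rewrite subr_gt0 exprn_ilt1.
have V0 : 0 < V by rewrite VE divr_gt0.
have L0 : 0 <= L.
  have := lipschitz_with_dist 1 0 lf; rewrite subr0 normr1 mulr1.
  exact: le_trans.
(* For the first integration [b] is the variable and [p = (x, a)] the parameter. *)
pose Lc h (p : R * R) b := h (max_comb p.1 p.2 b) : R.
have LcD h p r b : lipschitz_with L h ->
    Lc h p b <= Lc h r b + L * (`|p.1 - r.1| + `|p.2 - r.2|).
  move=> lh; apply: le_trans (lh _ (max_comb r.1 r.2 b)) _; rewrite lerD2l ler_wpM2l//.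
  rewrite ler_norml; have := max_comb_dist p.1 p.2 b r.1 r.2 b.
  have := max_comb_dist r.1 r.2 b p.1 p.2 b.
  rewrite !subrr !normr0 (distrC r.1) (distrC r.2); lra.
have LcL h p : lipschitz_with L h -> lipschitz_with L (Lc h p).
  move=> lh b b'; apply: le_trans (lh _ (max_comb p.1 p.2 b')) _; rewrite lerD2l ler_wpM2l//.
  rewrite ler_norml; have := max_comb_dist p.1 p.2 b p.1 p.2 b'.
  have := max_comb_dist p.1 p.2 b' p.1 p.2 b.
  rewrite !subrr !normr0 (distrC b'); lra.
pose k1 (p r : R * R) := (p.1 - r.1) ^+ 2 / (2 * v) + (p.2 - r.2) ^+ 2 / (2 * V).
have gf1 p r b b' : Lc g p b <= Lc f r b' + k1 p r + (b - b') ^+ 2 / (2 * V).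
  apply: le_trans (gf _ (max_comb r.1 r.2 b')) _; rewrite -addrA lerD2l.
  set x := p.1; set a := p.2; set x' := r.1; set a' := r.2.
  have cs (y z : R) : (y + q * z) ^+ 2 / (2 * V) <= y ^+ 2 / (2 * v) + z ^+ 2 / (2 * V).
    rewrite -subr_ge0 VE.
    have -> : y ^+ 2 / (2 * v) + z ^+ 2 / (2 * (v / (1 - q ^+ 2))) -
        (y + q * z) ^+ 2 / (2 * (v / (1 - q ^+ 2))) =
        (q * y - (1 - q ^+ 2) * z) ^+ 2 / (2 * v).
      by field; rewrite !gt_eqF.
    by rewrite divr_ge0 ?sqr_ge0// mulr_ge0// ltW.
  have cs1 := cs (x - x') (a - a').
  have cs2 := cs (x' - x) (b - b').
  have p1 : 0 <= (a - a') ^+ 2 / (2 * V) by rewrite divr_ge0 ?sqr_ge0// mulr_ge0// ltW.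
  have p2 : 0 <= (b - b') ^+ 2 / (2 * V) by rewrite divr_ge0 ?sqr_ge0// mulr_ge0// ltW.
  (* Only the branch that controls the difference is charged; the cost of the other subtree is
     nonnegative and is added for free. *)
  have [h|h] := max_dist_or (x + q * a) (- x + q * b) (x' + q * a') (- x' + q * b').
  - apply: (@le_trans _ _ ((x - x' + q * (a - a')) ^+ 2 / (2 * V))).
      rewrite ler_wpM2r ?invr_ge0 ?mulr_ge0// ?(ltW V0)//.
      rewrite -(real_normK (num_real (_ - _))) -[leRHS](real_normK (num_real _)).
      rewrite ler_sqr ?nnegrE//; apply: le_trans h _.
      by rewrite le_eqVlt; apply/orP; left; apply/eqP; congr `|_|; ring.
    by rewrite /k1 -/x -/a -/x' -/a'; lra.
  - apply: (@le_trans _ _ ((x' - x + q * (b - b')) ^+ 2 / (2 * V))).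
      rewrite ler_wpM2r ?invr_ge0 ?mulr_ge0// ?(ltW V0)//.
      rewrite -(real_normK (num_real (_ - _))) -[leRHS](real_normK (num_real _)).
      rewrite ler_sqr ?nnegrE//; apply: le_trans h _.
      by rewrite le_eqVlt; apply/orP; left; apply/eqP; congr `|_|; ring.
    have e : (x' - x) ^+ 2 = (x - x') ^+ 2 by ring.
    by rewrite /k1 -/x -/a -/x' -/a'; move: cs2; rewrite e; lra.
pose F1 := part_mean muB (Lc f); pose G1 := part_log muB (Lc g).
have F1D := part_mean_dist (intid iB) (fun p => LcL f p lf) (fun p r b => LcD f p r b lf).
have G1D := part_log_dist (intid iB) (fun p => LcL f p lf) (fun p => LcL g p lg)
  (fun p r b => LcD g p r b lg) tB gf1.
have GF1 := part_log_le (intid iB) (fun p => LcL f p lf) (fun p => LcL g p lg) tB gf1.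
have G1E := part_logE (intid iB) (fun p => LcL f p lf) (fun p => LcL g p lg) tB gf1.
have F1E := part_meanE (intid iB) (fun p => LcL f p lf).
rewrite -/F1 in F1D GF1 F1E; rewrite -/G1 in G1D GF1 G1E.
(* In the second integration [a] is the variable and [x] the parameter; the cost left over is the
   one that [tX] accepts. *)
pose f2 x a := F1 (x, a); pose g2 x a := G1 (x, a).
have f2L x : lipschitz_with L (f2 x).
  by move=> a a'; have := F1D (x, a) (x, a'); rewrite /= subrr normr0 add0r.
have g2L x : lipschitz_with L (g2 x).
  by move=> a a'; have := G1D (x, a) (x, a'); rewrite /= subrr normr0 add0r.
have f2D x x' a : f2 x a <= f2 x' a + L * `|x - x'|.
  by have := F1D (x, a) (x', a); rewrite /= subrr normr0 addr0.
have g2D x x' a : g2 x a <= g2 x' a + L * `|x - x'|.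
  by have := G1D (x, a) (x', a); rewrite /= subrr normr0 addr0.
have gf2 x x' a a' : g2 x a <= f2 x' a' + (x - x') ^+ 2 / (2 * v) + (a - a') ^+ 2 / (2 * V).
  by have := GF1 (x, a) (x', a'); rewrite /k1/= addrA.
have F2D : lipschitz_with L (part_mean muA f2).
  exact: (part_mean_dist (intid iA) f2L f2D).
have G2D : lipschitz_with L (part_log muA g2).
  exact: (@part_log_dist _ _ (intid iA) _ _ _ _ _ f2L g2L g2D _ tA _ gf2).
have GF2 := part_log_le (intid iA) f2L g2L tA gf2.
have h0 := tX L _ _ F2D G2D GF2.
have mg := lipschitz_with_measurable lg.
have mf := lipschitz_with_measurable lf.
rewrite ge0_integral_distribution; first last.
- by move=> y; rewrite lee_fin expR_ge0.
- by apply/measurable_EFinP; exact: measurableT_comp.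
rewrite (@ge0_integral_indep3 (fun x a b => (expR (g (max_comb x a b)))%:E)); first last.
- by move=> x a b; rewrite lee_fin expR_ge0.
- apply/measurable_EFinP; apply: measurableT_comp => //.
  by apply: measurableT_comp => //; exact: measurable_max_comb.
have -> : (\int[muX]_x \int[muA]_a \int[muB]_b (expR (g (max_comb x a b)))%:E =
  \int[muX]_x (expR (part_log muA g2 x))%:E)%E.
  apply: eq_integral => x _; rewrite -(part_logE (intid iA) f2L g2L tA gf2).
  by apply: eq_integral => a _; rewrite -G1E.
apply: le_trans h0 _.
have [if1 if2] := integrable_max_lipschitz lf.
rewrite [(\int[distribution P max_rv]_x _)%E]integral_distribution; last 2 first.
- by apply/measurable_EFinP.
- exact: if1.
rewrite (@integral_indep3 (fun x a b => (f (max_comb x a b))%:E)); last 3 first.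
- apply/measurable_EFinP.
  by apply: measurableT_comp => //; exact: measurable_max_comb.
- exact: if1.
- exact: if2.
have -> // : (\int[muX]_x \int[muA]_a \int[muB]_b (f (max_comb x a b))%:E =
  \int[muX]_x (part_mean muA f2 x)%:E)%E.
apply: eq_integral => x _; rewrite -(part_meanE (intid iA) f2L).
by apply: eq_integral => a _; rewrite -F1E.
Qed.

End max_step.

(** * From transport to exponential moments and variance *)

Section exponential_moments.
Context {R : realType}.

(** The difference of the two sides vanishes at 0 and its derivative [expR z + expR (- z) - 2] is a
    square. *)
Lemma expR_sub_ge (y : R) : 0 <= y -> 2 * y <= expR y - expR (- y).
Proof.
move=> y0; pose h (z : R) : R := expR z - expR (- z) - 2 * z.
have dh (z : R) : is_derive z 1 h (expR z + expR (- z) - 2).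
  have hN : is_derive z 1 (fun z : R => - z) (-1).
    by apply: is_derive_eq.
  have hE := @is_derive1_comp R expR (fun z => - z) z _ _ (is_derive_expR _) hN.
  rewrite /h.
  have -> : (fun z => expR z - expR (- z) - 2 * z) =
    expR - (expR \o (fun z : R => - z)) - (2 \*: @id R) by [].
  apply: is_derive_eq.
  by rewrite mulrN1 opprK [_%:A]mulr1.
have dh0 (z : R) : 0 <= expR z + expR (- z) - 2.
  have e : expR (z / 2) * expR (- (z / 2)) = 1 by rewrite -expRD subrr expR0.
  have -> : expR z + expR (- z) - 2 = (expR (z / 2) - expR (- (z / 2))) ^+ 2.
    rewrite sqrrB e.
    have -> : expR (z / 2) ^+ 2 = expR z by rewrite -expRM_natl; congr expR; field.
    have -> : expR (- (z / 2)) ^+ 2 = expR (- z) by rewrite -expRM_natl; congr expR; field.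
    by ring.
  exact: sqr_ge0.
have := is_derive_ge0_homo dh dh0 y0.
by rewrite /h oppr0 subrr mulr0 subrr; lra.
Qed.

(** Here [expR x + expR (- x) - 2] is the square of [expR (x / 2) - expR (- (x / 2))], which is
    compared with [x] by [expR_sub_ge]. *)
Lemma expR_add_ge (x : R) : 2 + x ^+ 2 <= expR x + expR (- x).
Proof.
have e : expR (x / 2) * expR (- (x / 2)) = 1 by rewrite -expRD subrr expR0.
have -> : expR x + expR (- x) = 2 + (expR (x / 2) - expR (- (x / 2))) ^+ 2.
  rewrite sqrrB e.
  have -> : expR (x / 2) ^+ 2 = expR x by rewrite -expRM_natl; congr expR; field.
  have -> : expR (- (x / 2)) ^+ 2 = expR (- x) by rewrite -expRM_natl; congr expR; field.
  by ring.
rewrite lerD2l -(real_normK (num_real x)) -[leRHS](real_normK (num_real _)).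
rewrite ler_sqr ?nnegrE//.
have [x0|x0] := leP 0 x.
  rewrite ger0_norm//; apply: le_trans (ler_norm _).
  by have := @expR_sub_ge (x / 2); lra.
rewrite ltr0_norm// distrC; apply: le_trans (ler_norm _).
by have := @expR_sub_ge (- (x / 2)); rewrite opprK; lra.
Qed.

Lemma expR_le_inv (u : R) : u < 1 -> expR u <= (1 - u)^-1.
Proof.
move=> u1; have u0 : 0 < 1 - u by rewrite subr_gt0.
rewrite -(invrK (expR u)) lef_pV2 ?posrE ?invr_gt0 ?expR_gt0//.
by rewrite -expRN; exact: expR_ge1Dx.
Qed.

(** This lets the parameter [v > 1] of the Gaussian inequality descend to 1. The choice
    [v = 1 + e / (c + 1)] also covers [c = 0]. *)
Lemma le_expR_lim (a b c : R) : 0 <= c ->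
  (forall v, 1 < v -> a <= expR (b + c * v)) -> a <= expR (b + c).
Proof.
move=> c0 h; have [a0|a0] := leP a 0; first exact: le_trans a0 (expR_ge0 _).
rewrite -(@lnK _ a) ?posrE// ler_expR; apply/ler_addgt0Pr => e e0.
have c1 : 0 < c + 1 by lra.
have v1 : 1 < 1 + e / (c + 1) by rewrite ltrDl divr_gt0.
have := h _ v1; rewrite -{1}(@lnK _ a) ?posrE// ler_expR => /le_trans; apply.
rewrite mulrDr mulr1 addrA lerD2l mulrCA ler_piMr ?(ltW e0)//.
by rewrite ler_pdivrMr// mul1r; lra.
Qed.

(** The maximum over [z] of [l * z - z ^+ 2 / (2 * V)] is [l ^+ 2 * V / 2]; lowering the linear [f]
    by this constant gives an admissible [g]. *)
Lemma transport_mgf (nu : probability R R) (V l : R) :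
  0 < V -> nu.-integrable setT (fun x => x%:E) -> transport_ineq nu V ->
  (\int[nu]_x (expR (l * x))%:E <=
    (expR (l * fine (\int[nu]_x x%:E) + l ^+ 2 * V / 2))%:E)%E.
Proof.
move=> V0 ii tV.
pose f (x : R) := l * x; pose g (x : R) := l * x - l ^+ 2 * V / 2.
have lf : lipschitz_with `|l| f.
  by move=> x y; rewrite /f -lerBlDl -mulrBr -normrM ler_norm.
have lg : lipschitz_with `|l| g.
  by move=> x y; have := lf x y; rewrite /f /g; lra.
have gf x y : g x <= f y + (x - y) ^+ 2 / (2 * V).
  rewrite /f /g -subr_ge0.
  have -> : l * y + (x - y) ^+ 2 / (2 * V) - (l * x - l ^+ 2 * V / 2) =
    ((x - y) - l * V) ^+ 2 / (2 * V) by field; rewrite gt_eqF.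
  by rewrite divr_ge0 ?sqr_ge0// mulr_ge0// ltW.
have := tV _ _ _ lf lg gf.
have -> : (\int[nu]_x (f x)%:E)%E = (l%:E * \int[nu]_x x%:E)%E.
  by under eq_integral do rewrite EFinM; rewrite integralZl.
rewrite fineM//; last exact: (integrable_fin_num measurableT ii).
move=> h; rewrite expRD EFinM.
rewrite (_ : (\int[nu]_x _)%E =
  ((expR (l ^+ 2 * V / 2))%:E * \int[nu]_x (expR (g x))%:E)%E).
  by rewrite muleC lee_wpmul2r// lee_fin expR_ge0.
rewrite -ge0_integralZl//.
- by apply: eq_integral => x _; rewrite -EFinM -expRD /g addrC subrK.
- apply/measurable_EFinP; apply: measurableT_comp => //.
  exact: lipschitz_with_measurable lg.
Qed.

(* [2 + x^2 <= e^x + e^(-x)] bounds [l^2] times the variance, and [l] tends to 0. *)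
Lemma variance_le_mgf d (T : measurableType d) (P : probability T R)
    (Y : T -> R) (m V : R) : 0 < V -> measurable_fun setT Y ->
  (forall l, (\int[P]_w (expR (l * Y w))%:E <= (expR (l * m + l ^+ 2 * V / 2))%:E)%E) ->
  (\int[P]_w ((Y w - m) ^+ 2)%:E <= V%:E)%E.
Proof.
move=> V0 mY h.
have mE l : measurable_fun setT (fun w => (expR (l * (Y w - m)))%:E).
  apply/measurable_EFinP; apply: measurableT_comp => //.
  by apply: measurable_funM => //; exact: measurable_funB.
have mS : measurable_fun setT (fun w => ((Y w - m) ^+ 2)%:E).
  by apply/measurable_EFinP; apply: measurable_funX; exact: measurable_funB.
have h' l : (\int[P]_w (expR (l * (Y w - m)))%:E <= (expR (l ^+ 2 * V / 2))%:E)%E.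
  have -> : (\int[P]_w (expR (l * (Y w - m)))%:E =
      (expR (- (l * m)))%:E * \int[P]_w (expR (l * Y w))%:E)%E.
    rewrite -ge0_integralZl//.
    - by apply: eq_integral => x _; rewrite -EFinM -expRD mulrBr addrC.
    - apply/measurable_EFinP; apply: measurableT_comp => //.
      exact: measurable_funM.
  have e0 : (0 <= (expR (- (l * m)))%:E)%E by rewrite lee_fin expR_ge0.
  apply: le_trans (lee_wpmul2l e0 (h l)) _.
  by rewrite -EFinM -expRD addrA addNr add0r.
have key l : ((l ^+ 2)%:E * \int[P]_w ((Y w - m) ^+ 2)%:E + 2%:E <=
    2%:E * (expR (l ^+ 2 * V / 2))%:E)%E.
  rewrite -ge0_integralZl//; last 2 first.
  - by move=> x _; rewrite lee_fin sqr_ge0.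
  - by rewrite lee_fin sqr_ge0.
  have -> : 2%:E = (\int[P]_w 2%:E)%E :> \bar R.
    by rewrite integral_cst//= probability_setT mule1.
  rewrite -ge0_integralD//; last 2 first.
  - by move=> x _; rewrite mule_ge0// lee_fin sqr_ge0.
  - by apply: measurable_funeM.
  rewrite integral_cst//= probability_setT mule1.
  apply: (@le_trans _ _ (\int[P]_w ((expR (l * (Y w - m)))%:E + (expR (- l * (Y w - m)))%:E))%E).
    apply: ge0_le_integral => //.
    - by move=> x _; rewrite adde_ge0// ?mule_ge0// lee_fin sqr_ge0.
    - by apply: emeasurable_funD => //; exact: measurable_funeM.
    - by apply: emeasurable_funD.
    - move=> x _; rewrite -EFinM -!EFinD lee_fin mulNr.
      by apply: le_trans (expR_add_ge _); rewrite exprMn addrC.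
  rewrite ge0_integralD//.
  rewrite (_ : 2 = 1 + 1 :> R)// EFinD ge0_muleDl// mul1e.
  by rewrite leeD// -(sqrrN l).
(* The case [l = 1] already shows that the integral is finite, and the rest is real arithmetic. *)
have fin : (\int[P]_w ((Y w - m) ^+ 2)%:E)%E \is a fin_num.
  rewrite ge0_fin_numE; last by apply: integral_ge0 => x _; rewrite lee_fin sqr_ge0.
  have := key 1; rewrite expr1n mul1e.
  case: (\int[P]_w _)%E => [r _|//|]; first by rewrite ltry.
  by rewrite ltNye.
move: key; rewrite -(fineK fin); set I := fine _ => key.
rewrite lee_fin; apply/ler_addgt0Pr => e e0.
have I0 : 0 <= I.
  by rewrite fine_ge0//; apply: integral_ge0 => x _; rewrite lee_fin sqr_ge0.
(* [u] is the value of [l ^+ 2 * V / 2]. It is chosen so that [(1 - u)^-1 = 1 + e / V], whence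
   [u * I <= e], that is [I <= V + e]. *)
pose u := e / (V + e).
have Ve : 0 < V + e by lra.
have u0 : 0 < u by rewrite divr_gt0.
have u1 : u < 1 by rewrite ltr_pdivrMr// mul1r; lra.
pose l := Num.sqrt (2 * u / V).
have l2 : l ^+ 2 = 2 * u / V by rewrite sqr_sqrtr// ltW// divr_gt0// mulr_gt0.
have := key l; rewrite l2 -!EFinM -EFinD lee_fin.
have -> : 2 * u / V * V / 2 = u by field; rewrite gt_eqF.
move=> k1.
have := expR_le_inv u1.
have -> : (1 - u)^-1 = 1 + e / V.
  by rewrite /u; field; rewrite !gt_eqF//= [V + e - e]addrK.
move=> k2.
have k3 : 2 * u / V * I <= 2 * (e / V) by lra.
have : u * I <= e by rewrite -(@ler_pM2l _ (2 / V)) ?divr_gt0//; lra.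
by rewrite /u mulrAC ler_pdivrMr// ler_pM2l.
Qed.

End exponential_moments.

(** * First and second moments through one step of the recursion *)

Section max_moments.
Context d (T : measurableType d) {R : realType} (P : probability T R).
Variables (X A B : {RV P >-> R}).
Hypotheses (X_AB : indep_pair P X (pair_rv A B)) (A_B : indep_pair P A B).
Local Notation muX := (distribution P X).
Local Notation muA := (distribution P A).
Local Notation muB := (distribution P B).
Variables (q : R) (q0 : 0 <= q).

Let integral_cstD (nu : probability R R) (c : R) (h : R -> R) :
  0 <= c -> measurable_fun [set: R] h -> (forall x, 0 <= h x) ->
  (\int[nu]_x (c + q * h x)%:E = c%:E + q%:E * \int[nu]_x (h x)%:E)%E.
Proof.
move=> c0 mh h0; under eq_integral do rewrite EFinD EFinM.
rewrite ge0_integralD//; last 2 first.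
- by move=> x _; rewrite mule_ge0// lee_fin.
- by apply: measurable_funeM; exact/measurable_EFinP.
rewrite integral_cst//= probability_setT mule1 ge0_integralZl//.
- exact/measurable_EFinP.
- by move=> x _; rewrite lee_fin.
Qed.

Lemma integral_max_rv_ge (l c : R) : (forall w, 0 <= A w) -> (forall w, 0 <= B w) ->
  (l%:E <= \int[P]_w (A w)%:E)%E -> (l%:E <= \int[P]_w (B w)%:E)%E ->
  (c%:E <= \int[muX]_x `|x|%:E)%E -> 0 <= l ->
  ((c + q * l)%:E <= \int[P]_w (max_rv X A B q w)%:E)%E.
Proof.
move=> A0 B0 lA lB cX l0.
(* The sign of [x] selects the branch. The absolute values of [a] and [b] make [f] nonnegative
   everywhere, as Tonelli requires, and disappear on the nonnegative variables [A] and [B]. *)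
pose f (x a b : R) := `|x| + q * (if 0 <= x then `|a| else `|b|).
have f0 x a b : 0 <= f x a b.
  by rewrite addr_ge0// mulr_ge0//; case: ifP.
have mf : measurable_fun [set: R * (R * R)] (fun z => f z.1 z.2.1 z.2.2).
  have m1 : measurable_fun [set: R * (R * R)] (fun z => z.1) by exact: measurable_fst.
  have m2 : measurable_fun [set: R * (R * R)] (fun z => z.2.1).
    by apply: measurableT_comp; [exact: measurable_fst|exact: measurable_snd].
  have m3 : measurable_fun [set: R * (R * R)] (fun z => z.2.2).
    by apply: measurableT_comp; [exact: measurable_snd|exact: measurable_snd].
  apply: measurable_funD; first exact: measurableT_comp.
  apply: measurable_funM => //; apply: measurable_fun_ifT.
  - exact: measurable_fun_ler.
  - exact: measurableT_comp.
  - exact: measurableT_comp.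
have fle w : f (X w) (A w) (B w) <= max_rv X A B q w.
  rewrite /f /= /max_comb; have [x0|x0] := leP 0 (X w).
    by rewrite !ger0_norm// le_max lexx.
  by rewrite ltr0_norm// ger0_norm// le_max lexx orbT.
apply: (@le_trans _ _ (\int[P]_w (f (X w) (A w) (B w))%:E)%E); last first.
  apply: ge0_le_integral => //.
  - by move=> w _; rewrite lee_fin.
  - apply/measurable_EFinP.
    exact: (measurableT_comp mf (measurable_fun_pair (measurable_funPT X)
      (measurable_funPT (pair_rv A B)))).
  - by apply/measurable_EFinP; exact: measurable_funPT.
  - by move=> w _; rewrite lee_fin.
rewrite (@ge0_integral_indep3 _ _ _ _ _ _ _ X_AB A_B (fun x a b => (f x a b)%:E)); last 2 first.
- exact/measurable_EFinP.
- by move=> x a b; rewrite lee_fin.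
have absE (Y : {RV P >-> R}) : (forall w, 0 <= Y w) ->
    (\int[distribution P Y]_y `|y|%:E = \int[P]_w (Y w)%:E)%E.
  move=> Y0; rewrite ge0_integral_distribution; first last.
  - by move=> y; rewrite lee_fin.
  - exact/measurable_EFinP.
  by apply: eq_integral => w _ /=; rewrite ger0_norm.
pose h (x : R) : \bar R := (`|x|%:E + q%:E * (if (0 <= x)%R then \int[P]_w (A w)%:E
  else \int[P]_w (B w)%:E))%E.
have hl x : ((`|x| + q * l)%:E <= h x)%E.
  rewrite EFinD EFinM leeD2l// lee_wpmul2l ?lee_fin//.
  by case: ifP.
have -> : (\int[muX]_x \int[muA]_a \int[muB]_b (f x a b)%:E = \int[muX]_x h x)%E.
  apply: eq_integral => x _; rewrite /f /h; have [x0|x0] := leP 0 x.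
    under eq_integral do rewrite integral_cst//= probability_setT mule1.
    by rewrite integral_cstD// absE.
  under eq_integral do rewrite integral_cstD//.
  by rewrite integral_cst//= probability_setT mule1 absE.
apply: (@le_trans _ _ (\int[muX]_x (`|x| + q * l)%:E)%E).
  under eq_integral do rewrite EFinD.
  rewrite ge0_integralD//; last by move=> x _; rewrite lee_fin mulr_ge0.
    by rewrite integral_cst//= probability_setT mule1 EFinD leeD2r.
  exact/measurable_EFinP.
apply: ge0_le_integral => //.
- by move=> x _; rewrite lee_fin addr_ge0// mulr_ge0.
- by apply/measurable_EFinP; exact: measurable_funD.
- apply: emeasurable_funD; first by apply/measurable_EFinP.
  apply: measurable_funeM; apply: measurable_fun_ifT => //.
  exact: measurable_fun_ler.
Qed.

Lemma integral_max_rv_sqr (m : \bar R) :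
  muX.-integrable setT (fun x => x%:E) -> (\int[muX]_x x%:E = 0)%E ->
  (\int[muX]_x (x ^+ 2)%:E <= 1)%E ->
  (\int[P]_w ((A w) ^+ 2)%:E <= m)%E -> (\int[P]_w ((B w) ^+ 2)%:E <= m)%E ->
  (\int[P]_w ((max_rv X A B q w) ^+ 2)%:E <= 2%:E + (2 * q ^+ 2)%:E * m)%E.
Proof.
move=> iX X0 X1 mA mB.
have iX2 : muX.-integrable setT (fun x => (x ^+ 2)%:E).
  apply/integrableP; split; first by apply/measurable_EFinP; exact: exprn_measurable.
  under eq_integral do rewrite gee0_abs ?lee_fin ?sqr_ge0//.
  by rewrite (le_lt_trans X1)// ltry.
pose f (y : R * R) (x : R) := (x + q * y.1) ^+ 2 + (- x + q * y.2) ^+ 2.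
have mf : measurable_fun [set: (R * R) * R] (fun z => f z.1 z.2).
  have m1 : measurable_fun [set: (R * R) * R] (fun z => z.2) by exact: measurable_snd.
  have m2 : measurable_fun [set: (R * R) * R] (fun z => z.1.1).
    by apply: measurableT_comp; [exact: measurable_fst|exact: measurable_fst].
  have m3 : measurable_fun [set: (R * R) * R] (fun z => z.1.2).
    by apply: measurableT_comp; [exact: measurable_snd|exact: measurable_fst].
  apply: measurable_funD; apply: measurable_funX; apply: measurable_funD => //.
  - exact: measurable_funM.
  - exact: measurableT_comp.
  - exact: measurable_funM.
have f0 y x : 0 <= f y x by rewrite addr_ge0// sqr_ge0.
(* [X] is integrated first: as it is centred, the cross terms vanish. *)
have AB_X : indep_pair P (pair_rv A B) X.
  by move=> E F mE mF; rewrite setIC X_AB// muleC.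
apply: (@le_trans _ _ (\int[P]_w (f (pair_rv A B w) (X w))%:E)%E).
  apply: ge0_le_integral => //.
  - by move=> w _; rewrite lee_fin sqr_ge0.
  - by apply/measurable_EFinP; apply: measurable_funX; exact: measurable_funPT.
  - apply/measurable_EFinP.
    exact: (measurableT_comp mf (measurable_fun_pair
      (measurable_funPT (pair_rv A B)) (measurable_funPT X))).
  - move=> w _; rewrite lee_fin /f /= /max_comb.
    by have [_|_] := leP (X w + q * A w) (- X w + q * B w); rewrite ?lerDl ?lerDr sqr_ge0.
rewrite (@ge0_integral_indep_pair _ _ _ P _ _ _ _ _ _ AB_X (fun z => (f z.1 z.2)%:E)); last 2 first.
- exact/measurable_EFinP.
- by move=> z; rewrite lee_fin.
have inner y : (\int[muX]_x (f y x)%:E <= (2 + q ^+ 2 * (y.1 ^+ 2 + y.2 ^+ 2))%:E)%E.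
  set c := q ^+ 2 * (y.1 ^+ 2 + y.2 ^+ 2).
  have icst (c' : R) : muX.-integrable setT (EFin \o cst c').
    exact: finite_measure_integrable_cst.
  rewrite (_ : (\int[muX]_x (f y x)%:E)%E = (\int[muX]_x
    (2%:E * (x ^+ 2)%:E + ((2 * q * (y.1 - y.2))%:E * x%:E + c%:E)))%E); last first.
    apply: eq_integral => x _; rewrite -!EFinM -!EFinD; congr EFin.
    by rewrite /f /c; ring.
  have i1 := integrableZl measurableT 2 iX2.
  have i2 := integrableZl measurableT (2 * q * (y.1 - y.2)) iX.
  have i3 := integrableD measurableT i2 (icst c).
  rewrite integralD// integralZl// integralD//; last exact: icst.
  rewrite integralZl// X0 mule0 add0e integral_cst//= probability_setT mule1.
  by rewrite [leRHS]EFinD leeD2r// -[leRHS]mule1 lee_wpmul2l// lee_fin.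
apply: (@le_trans _ _ (\int[distribution P (pair_rv A B)]_y
    (2 + q ^+ 2 * (y.1 ^+ 2 + y.2 ^+ 2))%:E)%E).
  apply: ge0_le_integral => //.
  - by move=> y _; apply: integral_ge0 => x _; rewrite lee_fin.
  - apply: (@measurable_fun_fubini_tonelli_F _ _ _ _ _ muX (fun z : (R * R) * R => (f z.1 z.2)%:E)).
    + by apply/measurable_EFinP.
    + by move=> z; rewrite lee_fin.
  - apply/measurable_EFinP; apply: measurable_funD => //; apply: measurable_funM => //.
    by apply: measurable_funD; apply: measurable_funX.
  by move=> y _; exact: inner.
rewrite (@ge0_integral_distribution _ _ _ _ _ P (pair_rv A B)
  (fun y : R * R => (2 + q ^+ 2 * (y.1 ^+ 2 + y.2 ^+ 2))%:E)); first last.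
- by move=> y; rewrite lee_fin addr_ge0// mulr_ge0 ?sqr_ge0// addr_ge0// sqr_ge0.
- apply/measurable_EFinP; apply: measurable_funD => //; apply: measurable_funM => //.
  by apply: measurable_funD; apply: measurable_funX.
have mA2 : measurable_fun setT (fun w => ((A w) ^+ 2)%:E).
  by apply/measurable_EFinP; apply: measurable_funX; exact: measurable_funPT.
have mB2 : measurable_fun setT (fun w => ((B w) ^+ 2)%:E).
  by apply/measurable_EFinP; apply: measurable_funX; exact: measurable_funPT.
have A20 w : (0 <= ((A w) ^+ 2)%:E)%E by rewrite lee_fin sqr_ge0.
have B20 w : (0 <= ((B w) ^+ 2)%:E)%E by rewrite lee_fin sqr_ge0.
have -> : (\int[P]_w ((fun y : R * R => (2 + q ^+ 2 * (y.1 ^+ 2 + y.2 ^+ 2))%:E) \o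
    pair_rv A B) w = \int[P]_w (2%:E +
    (q ^+ 2)%:E * ((A w ^+ 2)%:E + (B w ^+ 2)%:E)))%E by [].
have q20 : (0 <= (q ^+ 2)%:E)%E by rewrite lee_fin sqr_ge0.
rewrite ge0_integralD//; last 2 first.
- by move=> w _; rewrite mule_ge0// adde_ge0.
- by apply: measurable_funeM; exact: emeasurable_funD.
rewrite integral_cst//= probability_setT mule1 leeD2l//.
rewrite ge0_integralZl//; last 2 first.
- exact: emeasurable_funD.
- by move=> w _; rewrite adde_ge0.
rewrite ge0_integralD// (mulrC 2) [in leRHS]EFinM -[leRHS]muleA lee_wpmul2l//.
by rewrite (_ : 2 = 1 + 1 :> R)// EFinD ge0_muleDl// mul1e leeD.
Qed.

End max_moments.

(** * The maximum over the binary tree *)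

Section disjoint_blocks.
Context d (T : measurableType d) {R : realType} (P : probability T R).
Variables (I : eqType) (N : I -> {RV P >-> R}).
Hypothesis N_indep : mutually_independent N.
Implicit Types J K : pred I.

(** Finite-dimensional events over the block [J]: a pi-system generating the sigma-algebra of the
    block, ready for uniqueness of measures. The list may repeat indices, which makes closure under
    intersection a concatenation. *)
Definition cylinders J : set (set T) :=
  [set E | exists s (A : I -> set R), [/\ all J s, (forall i, measurable (A i)) &
     E = [set w | forall i, i \in s -> A i (N i w)]]].

Lemma cylinders_measurable J : cylinders J `<=` measurable.
Proof.
move=> _ [s [A [_ mA ->]]].
elim: s => [|i s ih].
  rewrite (_ : [set _ | _] = setT)//.
  by apply/seteqP; split => // w _ i.
rewrite (_ : [set _ | _] = N i @^-1` A i `&` [set w | forall j, j \in s -> A j (N j w)]).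
  by apply: measurableI => //; exact: measurable_funPTI.
apply/seteqP; split => [w h|w [h1 h2] j]/=.
  split; first by apply: h; rewrite mem_head.
  by move=> j js; apply: h; rewrite inE js orbT.
by rewrite inE => /predU1P[->|/h2].
Qed.

Lemma cylindersT J : cylinders J setT.
Proof.
exists [::], (fun=> setT); split => //.
by apply/seteqP; split => // w _ i.
Qed.

Lemma cylindersI J : setI_closed (cylinders J).
Proof.
move=> _ _ [s [A [sJ mA ->]]] [t [B [tJ mB ->]]].
exists (s ++ t), (fun i => (if i \in s then A i else setT) `&`
                           (if i \in t then B i else setT)); split.
- by rewrite all_cat sJ.
- by move=> i; apply: measurableI; case: ifP.
- apply/seteqP; split => [w [h1 h2] i _|w h].
    by split; case: ifP => //; [exact: h1|exact: h2].
  split=> i /= it.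
  + by have [] := h i; rewrite ?mem_cat ?it.
  + by have [] := h i; rewrite ?mem_cat ?it ?orbT.
Qed.

Lemma cylinders_sub J K : subpred J K -> cylinders J `<=` cylinders K.
Proof.
move=> JK _ [s [A [sJ mA ->]]]; exists s, A; split => //.
exact: sub_all sJ.
Qed.

(** After removing repetitions the two lists are concatenated and their sets glued along [J];
    disjointness of the blocks keeps the list duplicate-free, so mutual independence applies three
    times. *)
Lemma cylinders_indep J K E F : (forall i, J i -> K i -> False) ->
  cylinders J E -> cylinders K F -> P (E `&` F) = (P E * P F)%E.
Proof.
move=> JK [s [A [sJ mA ->]]] [t [B [tK mB ->]]].
have us : [set w | forall i, i \in s -> A i (N i w)] =
          [set w | forall i, i \in undup s -> A i (N i w)].
  by apply/seteqP; split => w h i; have := h i; rewrite mem_undup.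
have ut : [set w | forall i, i \in t -> B i (N i w)] =
          [set w | forall i, i \in undup t -> B i (N i w)].
  by apply/seteqP; split => w h i; have := h i; rewrite mem_undup.
rewrite us ut !N_indep ?undup_uniq//.
pose C i := if J i then A i else B i.
have Js i : i \in undup s -> J i by rewrite mem_undup => /(allP sJ).
have Kt i : i \in undup t -> K i by rewrite mem_undup => /(allP tK).
have Jt i : i \in undup t -> J i = false.
  by move=> /Kt Ki; apply/negP => /JK; exact.
have -> : [set w | forall i, i \in undup s -> A i (N i w)] `&`
    [set w | forall i, i \in undup t -> B i (N i w)] =
    [set w | forall i, i \in undup s ++ undup t -> C i (N i w)].
  apply/seteqP; split => [w [h1 h2] i|w h].
    rewrite mem_cat => /orP[h|h]; rewrite /C.
      by rewrite Js//; exact: h1.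
    by rewrite Jt//; exact: h2.
  split => i /= h'; have := h i; rewrite mem_cat h' ?orbT /C => /(_ isT).
    by rewrite Js.
  by rewrite Jt.
rewrite N_indep.
- rewrite big_cat/=; congr (_ * _)%E.
    by rewrite big_seq [RHS]big_seq; apply: eq_bigr => i /Js Ji; rewrite /C Ji.
  by rewrite big_seq [RHS]big_seq; apply: eq_bigr => i /Jt Ji; rewrite /C Ji.
- rewrite cat_uniq !undup_uniq/= andbT; apply/hasPn => i it.
  by apply/negP => /Js; rewrite Jt.
- by move=> i; rewrite /C; case: ifP.
Qed.

(** For a fixed cylinder [F], both sides are finite measures in [E], namely [P] restricted to [F]
    and [P] scaled by [P F]; they agree on a pi-system. *)
Let sigma_indep1 J K F : (forall i, J i -> K i -> False) ->
  cylinders K F -> forall E, <<s cylinders J >> E -> P (E `&` F) = (P E * P F)%E.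
Proof.
move=> JK KF E JE.
have mF : measurable F := cylinders_measurable KF.
have F0 : 0 <= fine (P F) by rewrite fine_ge0.
have PFE : P F = (fine (P F))%:E by rewrite fineK// fin_num_measure.
have -> : P (E `&` F) = mrestr P mF E by [].
rewrite PFE muleC.
have -> : ((fine (P F))%:E * P E)%E = mscale (NngNum F0) P E by [].
apply: (@g_sigma_algebra_measure_unique _ _ _ (cylinders J) (@cylinders_measurable J)
  (fun=> setT)) JE => //.
- by move=> _; exact: cylindersT.
- by rewrite bigcup_const//; exists 0%N.
- exact: cylindersI.
- move=> A JA; rewrite /mrestr/= /mscale/= -PFE [RHS]muleC.
  exact: (cylinders_indep JK).
- by move=> _; rewrite /= /mrestr setTI -ge0_fin_numE// fin_num_measure.
Qed.

(** The same uniqueness argument in the second event, with [E] now arbitrary in its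
    sigma-algebra. *)
Lemma sigma_indep J K E F : (forall i, J i -> K i -> False) ->
  <<s cylinders J >> E -> <<s cylinders K >> F -> P (E `&` F) = (P E * P F)%E.
Proof.
move=> JK JE.
have mE : measurable E.
  by move: E JE; apply: smallest_sub => //; [exact: sigma_algebra_measurable|exact: cylinders_measurable].
have E0 : 0 <= fine (P E) by rewrite fine_ge0.
have PEE : P E = (fine (P E))%:E by rewrite fineK// fin_num_measure.
move=> KF.
have -> : P (E `&` F) = mrestr P mE F by rewrite /mrestr setIC.
rewrite PEE.
have -> : ((fine (P E))%:E * P F)%E = mscale (NngNum E0) P F by [].
apply: (@g_sigma_algebra_measure_unique _ _ _ (cylinders K) (@cylinders_measurable K)
  (fun=> setT)) KF => //.
- by move=> _; exact: cylindersT.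
- by rewrite bigcup_const//; exists 0%N.
- exact: cylindersI.
- move=> A KA; rewrite -[LHS]/(P (A `&` E)) -[RHS]/((fine (P E))%:E * P A)%E.
  by rewrite -PEE setIC; exact: (sigma_indep1 JK).
- by move=> _; rewrite /= /mrestr setTI -ge0_fin_numE// fin_num_measure.
Qed.

End disjoint_blocks.

(** * The recursive maximum: independence, concentration and moments *)

Section tree_maximum.
Context d (T : measurableType d) {R : realType} (P : probability T R).
Variable N : seq bool -> {RV P >-> R}.
Hypothesis N_indep : mutually_independent N.
Hypothesis N_normal : forall w, standard_normal (N w).
Variable q : R.
Hypothesis q01 : 0 <= q < 1.

(** [n] levels below the node [w]. The recursion splits at the top, where the two subtrees are
    independent of each other and of [N w]; [path_value_tree_max] recovers the description by
    paths. *)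
Fixpoint tree_max n w : {RV P >-> R} :=
  if n is n'.+1 then
    max_rv (N w) (tree_max n' (rcons w false)) (tree_max n' (rcons w true)) q
  else mfun_of (measurable_cst (0 : R)).

(** Measurability with respect to the sigma-algebra of the block [J], stated through preimages so
    that [T] keeps its own measurable structure; [sigma_determinedP] translates. *)
Definition sigma_determined d1 (T1 : measurableType d1) (J : pred (seq bool))
    (X : T -> T1) :=
  forall B, measurable B -> <<s cylinders N J >> (X @^-1` B).

Lemma sigma_determinedP d1 (T1 : measurableType d1) J (X : T -> T1) :
  sigma_determined J X <->
  measurable_fun [set: g_sigma_algebraType (cylinders N J)] X.
Proof.
split=> [h _ B mB|h B mB]; first by rewrite setTI; exact: h.
by rewrite -[X in <<s _ >> X]setTI; exact: h.
Qed.

Lemma sigma_determined_sub d1 (T1 : measurableType d1) J K (X : T -> T1) :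
  subpred J K -> sigma_determined J X -> sigma_determined K X.
Proof.
move=> JK h B mB; apply: sub_sigma_algebra2 (h _ mB).
exact: cylinders_sub.
Qed.

Lemma sigma_determined_pair J (X Y : {RV P >-> R}) :
  sigma_determined J X -> sigma_determined J Y -> sigma_determined J (pair_rv X Y).
Proof.
move=> /sigma_determinedP hX /sigma_determinedP hY; apply/sigma_determinedP.
exact: measurable_fun_pair.
Qed.

Lemma sigma_determined_max J (X Y Z : {RV P >-> R}) : sigma_determined J X ->
  sigma_determined J Y -> sigma_determined J Z -> sigma_determined J (max_rv X Y Z q).
Proof.
move=> /sigma_determinedP hX /sigma_determinedP hY /sigma_determinedP hZ.
apply/sigma_determinedP.
exact: (measurableT_comp (measurable_max_comb q)
  (measurable_fun_pair hX (measurable_fun_pair hY hZ))).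
Qed.

Lemma sigma_determined_indep d1 (T1 : measurableType d1) d2 (T2 : measurableType d2)
    (J K : pred (seq bool)) (X : T -> T1) (Y : T -> T2) : (forall i, J i -> K i -> False) ->
  sigma_determined J X -> sigma_determined K Y -> indep_pair P X Y.
Proof.
move=> JK hX hY E F mE mF.
by apply: (sigma_indep N_indep JK); [exact: hX|exact: hY].
Qed.

Lemma sigma_determined_node w : sigma_determined (pred1 w) (N w).
Proof.
move=> B mB; apply: sub_sigma_algebra.
exists [:: w], (fun=> B); split => //=; first by rewrite eqxx.
apply/seteqP; split => [x h i|x h]; first by rewrite inE => /eqP ->.
by apply: (h w); rewrite inE.
Qed.

Lemma sigma_determined_tree_max n w : sigma_determined (prefix w) (tree_max n w).
Proof.
elim: n w => [|n ih] w.
  by apply/sigma_determinedP; exact: measurable_cst.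
apply: sigma_determined_max.
- apply: sigma_determined_sub (@sigma_determined_node w) => v /eqP ->.
  exact: prefix_refl.
- by apply: sigma_determined_sub (ih _) => v; apply: prefix_trans; exact: prefix_rcons.
- by apply: sigma_determined_sub (ih _) => v; apply: prefix_trans; exact: prefix_rcons.
Qed.

Lemma tree_max_indep_children n w :
  indep_pair P (tree_max n (rcons w false)) (tree_max n (rcons w true)).
Proof.
apply: sigma_determined_indep (@sigma_determined_tree_max _ _)
  (@sigma_determined_tree_max _ _) => v.
(* Descendants of the two children differ at the digit in position [size w]. *)
move=> /prefixP[s ->] /prefixP[s'] /(congr1 (drop (size w))).
by rewrite !cat_rcons !drop_size_cat.
Qed.

Lemma tree_max_indep_node n w : indep_pair P (N w)
  (pair_rv (tree_max n (rcons w false)) (tree_max n (rcons w true))).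
Proof.
(* The second block consists of the strict descendants of [w]: it contains both subtrees and avoids
   [w]. *)
apply: (@sigma_determined_indep _ _ _ _ (pred1 w)
  (fun v => prefix w v && (v != w)) (N w) _ _ (@sigma_determined_node w)).
  by move=> v /eqP ->; rewrite eqxx andbF.
have sub b v : prefix (rcons w b) v -> prefix w v && (v != w).
  move=> h; rewrite (prefix_trans (prefix_rcons _ _) h).
  by apply: contraTneq h => ->; rewrite prefixE -cats1 size_cat/= take_oversize ?addn1// -{1}(cats0 w) eqseq_cat// eqxx.
by apply: sigma_determined_pair; apply: sigma_determined_sub (@sigma_determined_tree_max _ _) => v;
  exact: sub.
Qed.

Lemma tree_max_ge0 n w o : 0 <= tree_max n w o.
Proof.
case: n w => [//|n] w; elim: n w => [|n ih] w /=; rewrite /max_comb le_max.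
  by rewrite !mulr0 !addr0 oppr_ge0; case: (leP 0 (N w o)) => // /ltW.
have /andP[q0 _] := q01.
have [x0|/ltW x0] := leP 0 (N w o).
  by rewrite addr_ge0// mulr_ge0//; exact: ih.
by rewrite [X in _ || X]addr_ge0 ?orbT// ?oppr_ge0// mulr_ge0//; exact: ih.
Qed.

Let gaussE w A : measurable A -> distribution P (N w) A = normal_prob (0 : R) 1 A.
Proof. exact: N_normal. Qed.

Lemma integrable_node w : P.-integrable setT (EFin \o N w).
Proof.
have ii := integrable_gauss_id (@gaussE w).
apply/integrableP; split; first by apply/measurable_EFinP; exact: measurable_funPT.
case/integrableP : ii => _; rewrite ge0_integral_distribution//.
by apply: measurableT_comp => //; exact/measurable_EFinP.
Qed.

Lemma integrable_tree_max n w : P.-integrable setT (EFin \o tree_max n w).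
Proof.
elim: n w => [|n ih] w /=; first exact: finite_measure_integrable_cst.
by apply: integrable_max_rv => //; exact: integrable_node.
Qed.

Lemma transport_tree_max n w v : 1 < v ->
  transport_ineq (distribution P (tree_max n w)) (v / (1 - q ^+ 2)).
Proof.
move=> v1; have v0 : 0 < v by exact: lt_trans v1.
elim: n w => [|n ih] w.
  (* The law of the constant 0 is a point mass, for which the hypothesis at [(0, 0)] is the whole
     claim. *)
  move=> L f g lf lg gf.
  have mf := lipschitz_with_measurable lf; have mg := lipschitz_with_measurable lg.
  rewrite ge0_integral_distribution; last 2 first.
  - by apply/measurable_EFinP; exact: measurableT_comp.
  - by move=> y; rewrite lee_fin expR_ge0.
  rewrite [X in fine X]integral_distribution; last 2 first.
  - exact/measurable_EFinP.
  - exact: (finite_measure_integrable_cst P (f 0)).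
  rewrite /comp /= !integral_cst//= probability_setT !mule1 lee_fin ler_expR.
  by have := gf 0 0; rewrite subrr expr0n mul0r addr0.
apply: (@transport_ineq_max _ _ _ _ _ _ _ (@tree_max_indep_node n w)
  (@tree_max_indep_children n w) _ q01 (@integrable_node w)
  (@integrable_tree_max n _) (@integrable_tree_max n _) v) => //.
exact: gauss_transport_ineq (@gaussE w) v1.
Qed.

Lemma integrable_law (Y : {RV P >-> R}) : P.-integrable setT (EFin \o Y) ->
  (distribution P Y).-integrable setT (fun x => x%:E).
Proof.
by move=> iY; apply: integrable_pushforward => //; exact/measurable_EFinP.
Qed.

Lemma integral_law (Y : {RV P >-> R}) : P.-integrable setT (EFin \o Y) ->
  (\int[distribution P Y]_x x%:E = \int[P]_w (Y w)%:E)%E.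
Proof.
by move=> iY; rewrite integral_distribution//; exact/measurable_EFinP.
Qed.

Lemma mgf_tree_max n w l :
  (\int[P]_o (expR (l * tree_max n w o))%:E <=
    (expR (l * fine (\int[P]_o (tree_max n w o)%:E) +
           l ^+ 2 * (1 - q ^+ 2)^-1 / 2))%:E)%E.
Proof.
have /andP[q0 q1] := q01.
have q2 : 0 < 1 - q ^+ 2 by rewrite subr_gt0 exprn_ilt1.
have it := integrable_tree_max n w.
have h v : 1 < v -> (\int[P]_o (expR (l * tree_max n w o))%:E <=
    (expR (l * fine (\int[P]_o (tree_max n w o)%:E) +
           l ^+ 2 * (1 - q ^+ 2)^-1 / 2 * v))%:E)%E.
  move=> v1.
  have V0 : 0 < v / (1 - q ^+ 2) by rewrite divr_gt0// (lt_trans ltr01 v1).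
  have := transport_mgf l V0 (integrable_law it) (transport_tree_max n w v1).
  rewrite integral_law// ge0_integral_distribution; last 2 first.
  - by apply/measurable_EFinP; apply: measurableT_comp => //; exact: measurable_funM.
  - by move=> y; rewrite lee_fin expR_ge0.
  move=> /le_trans; apply; rewrite lee_fin ler_expR lerD2l.
  by rewrite le_eqVlt; apply/orP; left; apply/eqP; field; rewrite gt_eqF.
(* Finiteness follows from the sample value [v = 2]; afterwards [v] descends to 1. *)
have fin : (\int[P]_o (expR (l * tree_max n w o))%:E)%E \is a fin_num.
  rewrite ge0_fin_numE; last by apply: integral_ge0 => o _; rewrite lee_fin expR_ge0.
  by apply: le_lt_trans (h 2 _) _; rewrite ?ltry// ltr1n.
rewrite -(fineK fin) lee_fin; apply: le_expR_lim.
  by rewrite divr_ge0// mulr_ge0 ?sqr_ge0// invr_ge0 ltW.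
by move=> v /h; rewrite -(fineK fin) lee_fin.
Qed.

Lemma node_mean0 w : (\int[distribution P (N w)]_x x%:E = 0)%E.
Proof. exact: integral_gauss_id (@gaussE w). Qed.

(** Obtained from the Gaussian transport inequality with parameter [1 + e], through the variance
    bound, for every [e > 0]. *)
Lemma node_second_moment w : (\int[distribution P (N w)]_x (x ^+ 2)%:E <= 1)%E.
Proof.
have ii := integrable_gauss_id (@gaussE w).
apply/lee_addgt0Pr => e e0.
have e1 : 1 < 1 + e by rewrite ltrDl.
have V0 : 0 < 1 + e by rewrite addr_gt0.
have := @variance_le_mgf R _ _ (distribution P (N w)) id 0 (1 + e) V0 _ _.
rewrite -EFinD; under eq_integral do rewrite subr0; apply => //.
move=> l; have := transport_mgf l V0 ii (gauss_transport_ineq (@gaussE w) e1).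
by rewrite node_mean0.
Qed.

(** The bound is the fixed point of [m = 2 + 2 * q ^+ 2 * m], hence uniform in [n]. *)
Lemma second_moment_tree_max n w : 2 * q ^+ 2 < 1 ->
  (\int[P]_o ((tree_max n w o) ^+ 2)%:E <= (2 / (1 - 2 * q ^+ 2))%:E)%E.
Proof.
move=> q2; have q2' : 0 < 1 - 2 * q ^+ 2 by rewrite subr_gt0.
have /andP[q0 q1] := q01.
elim: n w => [|n ih] w.
  by rewrite /= expr0n integral_cst//= mul0e lee_fin ltW// divr_gt0.
apply: le_trans (integral_max_rv_sqr (@tree_max_indep_node n w) q
  (integrable_law (integrable_node w)) (node_mean0 w) (node_second_moment w)
  (ih _) (ih _)) _.
rewrite -EFinM -EFinD lee_fin le_eqVlt; apply/orP; left; apply/eqP.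
by field; rewrite gt_eqF.
Qed.

(** Iterates from 0 of the lower bound in [integral_max_rv_ge]; the constant
    [Num.sqrt 2 / Num.sqrt pi] is the mean of [|N w|]. *)
Fixpoint mean_lower n : R :=
  if n is n'.+1 then Num.sqrt 2 / Num.sqrt pi + q * mean_lower n' else 0.

Lemma mean_lower_ge0 n : 0 <= mean_lower n.
Proof.
have /andP[q0 q1] := q01.
by elim: n => [|n ih] //=; rewrite addr_ge0 ?mulr_ge0// divr_ge0.
Qed.

Lemma mean_tree_max n w : ((mean_lower n)%:E <= \int[P]_o (tree_max n w o)%:E)%E.
Proof.
have /andP[q0 q1] := q01.
elim: n w => [|n ih] w.
  by rewrite /= integral_cst//= mul0e.
apply: (integral_max_rv_ge (@tree_max_indep_node n w) (@tree_max_indep_children n w) q0) => //.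
- by move=> o; exact: tree_max_ge0.
- by move=> o; exact: tree_max_ge0.
- by rewrite (integral_gauss_abs (@gaussE w)).
- exact: mean_lower_ge0.
Qed.

End tree_maximum.

(** * Binary expansions *)

Section binary.
Context {R : realType}.
Implicit Types (b : nat -> bool) (t : R).

Definition binsum b : R^nat := series (fun i => (b i)%:R * (2^-1 : R) ^+ i.+1).

Lemma binsum0 b : binsum b 0 = 0.
Proof. by rewrite /binsum /series/= big_geq. Qed.

Lemma binsumS b n : binsum b n.+1 = binsum b n + (b n)%:R * 2^-1 ^+ n.+1.
Proof. by rewrite /binsum seriesSr. Qed.

Let half_gt0 n : 0 < (2^-1 : R) ^+ n.
Proof. by rewrite exprn_gt0// invr_gt0. Qed.

Let halfS n : (2^-1 : R) ^+ n = 2^-1 ^+ n.+1 + 2^-1 ^+ n.+1.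
Proof. by rewrite exprS; field. Qed.

Let half_cvg0 : (2^-1 : R) ^+ n @[n --> \oo] --> 0.
Proof.
by apply: cvg_expr; rewrite ger0_norm ?invf_lt1 ?ltr1n// invr_ge0.
Qed.

Lemma binsum_nondecreasing b : nondecreasing_seq (binsum b).
Proof.
by apply/nondecreasing_seqP => n; rewrite binsumS lerDl mulr_ge0.
Qed.

(** These are the right ends of the nested dyadic intervals whose left ends are the partial sums. *)
Lemma binsum_upper_nonincreasing b :
  nonincreasing_seq (fun n => binsum b n + 2^-1 ^+ n).
Proof.
apply/nonincreasing_seqP => n; rewrite binsumS -addrA lerD2l (halfS n) lerD2r.
by case: (b n); rewrite ?mul1r// mul0r ltW.
Qed.

Lemma binsum_le1 b n : binsum b n <= 1.
Proof.
have := binsum_upper_nonincreasing b (leq0n n).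
by rewrite binsum0 add0r expr0; apply: le_trans; rewrite lerDl ltW.
Qed.

Lemma binsum_bounds b t n : binsum b @ \oo --> t ->
  binsum b n <= t <= binsum b n + 2^-1 ^+ n.
Proof.
move=> bt; apply/andP; split.
  rewrite -(cvg_lim (@Rhausdorff R) bt); apply: nondecreasing_cvgn_le.
    exact: binsum_nondecreasing.
  by apply/cvg_ex; exists t.
have vt : binsum b n + 2^-1 ^+ n @[n --> \oo] --> t.
  by rewrite -[X in _ --> X]addr0; exact: cvgD.
rewrite -[leLHS](cvg_lim (@Rhausdorff R) vt); apply: nonincreasing_cvgn_ge.
  exact: binsum_upper_nonincreasing.
by apply/cvg_ex; exists t.
Qed.

(** A digit 0 at position [i] leaves a gap of [2^-1 ^+ i.+1] below the right end of the dyadic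
    interval. *)
Lemma binsum_bounds_lt b t n i : binsum b @ \oo --> t -> (n <= i)%N ->
  b i = false -> t < binsum b n + 2^-1 ^+ n.
Proof.
move=> bt ni bi.
have /andP[_ h] := binsum_bounds i.+1 bt.
apply: le_lt_trans h _; apply: lt_le_trans (binsum_upper_nonincreasing b ni).
by rewrite binsumS bi mul0r addr0 ltrD2l (halfS i) ltrDl.
Qed.

Lemma binsum_cvg_bounds b t : (forall n, binsum b n <= t <= binsum b n + 2^-1 ^+ n) ->
  binsum b @ \oo --> t.
Proof.
move=> h; apply: (@squeeze_cvgr _ _ _ _ (fun n => t - 2^-1 ^+ n) (fun=> t)).
- by near=> n; have := h n; rewrite lerBlDr => /andP[-> ->].
- by rewrite -[X in _ --> X]subr0; apply: cvgB => //; exact: cvg_cst.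
- exact: cvg_cst.
Unshelve. all: by end_near. Qed.

Lemma binsum_dyadic b n : exists m : nat, binsum b n = m%:R * 2^-1 ^+ n.
Proof.
elim: n => [|n [m e]]; first by exists 0%N; rewrite binsum0 mul0r.
exists (2 * m + b n)%N; rewrite binsumS e natrD natrM exprS.
by case: (b n) => /=; field.
Qed.

(** For [t < 1] zeros occur arbitrarily late, so both partial sums are the left end of the half-open
    dyadic interval of level [n] around [t], and their integer numerators coincide. For [t = 1] a
    single 0 would force [t < 1]. *)
Lemma binary_expansion_inj b b' t :
  binary_expansion t b -> binary_expansion t b' -> b =1 b'.
Proof.
move=> [bt b0] [bt' b0'].
have [t1|t1] := ltP t 1.
  have eqS n : binsum b n = binsum b' n.
    have [i ni bi] := b0 t1 n; have [i' ni' bi'] := b0' t1 n.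
    have h1 := binsum_bounds_lt bt ni bi; have h2 := binsum_bounds_lt bt' ni' bi'.
    have /andP[h3 _] := binsum_bounds n bt; have /andP[h4 _] := binsum_bounds n bt'.
    have [m e] := binsum_dyadic b n; have [m' e'] := binsum_dyadic b' n.
    move: h1 h2 h3 h4; rewrite e e' => h1 h2 h3 h4.
    have : m%:R * 2^-1 ^+ n < m'.+1%:R * 2^-1 ^+ n :> R.
      by apply: le_lt_trans h3 _; apply: lt_le_trans h2 _; rewrite -[m'.+1%:R]natr1 mulrDl mul1r.
    have : m'%:R * 2^-1 ^+ n < m.+1%:R * 2^-1 ^+ n :> R.
      by apply: le_lt_trans h4 _; apply: lt_le_trans h1 _; rewrite -[m.+1%:R]natr1 mulrDl mul1r.
    rewrite !ltr_pM2r// !ltr_nat => a1 a2; congr (_%:R * _).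
    by apply/eqP; rewrite eqn_leq; move: a1 a2; rewrite !ltnS => -> ->.
  move=> n; have := eqS n.+1; rewrite !binsumS eqS => /addrI.
  by case: (b n); case: (b' n) => //=; rewrite mul1r mul0r => /eqP; rewrite ?[0 == _]eq_sym gt_eqF.
have all1 c : binsum c @ \oo --> t -> forall n, c n = true.
  move=> ct n; apply/negPn/negP => /negbTE cn.
  have := binsum_bounds_lt ct (leq0n n) cn; rewrite binsum0 add0r expr0.
  by rewrite ltNge t1.
by move=> n; rewrite !all1.
Qed.

Lemma binary_expansion_ex t : 0 <= t <= 1 -> exists b, binary_expansion t b.
Proof.
move=> /andP[t0]; rewrite le_eqVlt => /predU1P[->|t1].
  exists (fun=> true); split; last by rewrite ltxx.
  apply: binsum_cvg_bounds => n.
  have -> : binsum (fun=> true) n = 1 - 2^-1 ^+ n.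
    elim: n => [|n ih]; first by rewrite binsum0 expr0 subrr.
    by rewrite binsumS ih (halfS n) mul1r; ring.
  by rewrite subrK lexx andbT lerBlDr lerDl ltW.
(* [m k] is the integer part of [2^k t]; the digits are the parities of these numbers. *)
pose m k := Num.truncn (t * 2 ^+ k).
pose b i := odd (m i.+1).
have tk0 k : 0 <= t * 2 ^+ k by rewrite mulr_ge0// exprn_ge0.
have mS k : m k.+1 = (2 * m k + b k)%N.
  have /andP[h1 h2] := truncn_itv (tk0 k).
  rewrite -/(m k) in h1 h2.
  have l1 : (2 * m k <= m k.+1)%N.
    by rewrite /m truncn_ge_nat// natrM exprS mulrCA ler_pM2l.
  have l2 : (m k.+1 < 2 * (m k).+1)%N.
    by rewrite /m truncn_lt_nat// natrM exprS mulrCA ltr_pM2l.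
  by rewrite /b; lia.
have Se k : binsum b k = (m k)%:R * 2^-1 ^+ k.
  elim: k => [|k ih].
    rewrite binsum0 /m expr0 mulr1 (_ : Num.truncn t = 0%N) ?mul0r//.
    by apply/eqP; rewrite truncn_eq// t0.
  by rewrite binsumS ih mS natrD natrM exprS; field.
have e2 k : (2 ^+ k : R) * 2^-1 ^+ k = 1 by rewrite -exprMn mulfV// expr1n.
have bds k : binsum b k <= t /\ t < binsum b k + 2^-1 ^+ k.
  have /andP[h1 h2] := truncn_itv (tk0 k); rewrite -/(m k) in h1 h2.
  rewrite Se; split.
    apply: (@le_trans _ _ ((t * 2 ^+ k) * 2^-1 ^+ k)); first by rewrite ler_pM2r.
    by rewrite -mulrA e2 mulr1.
  apply: (@le_lt_trans _ _ ((t * 2 ^+ k) * 2^-1 ^+ k)).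
    by rewrite -mulrA e2 mulr1.
  by rewrite -[X in _ + X]mul1r -mulrDl natr1 ltr_pM2r.
exists b; split.
  apply: binsum_cvg_bounds => n; have [h1 h2] := bds n.
  by rewrite h1 ltW.
(* If all digits from [k] on were 1, the partial sums would increase to [binsum b k + 2^-1 ^+ k],
   which is strictly above [t]. *)
move=> _ k; apply: contrapT => hk.
have bk i : (k <= i)%N -> b i = true.
  by move=> ki; apply/negPn/negP => /negbTE bi; apply: hk; exists i.
have Sk j : binsum b (k + j)%N = binsum b k + 2^-1 ^+ k - 2^-1 ^+ (k + j)%N.
  elim: j => [|j ih]; first by rewrite addn0 addrK.
  rewrite addnS binsumS ih bk ?leq_addr// mul1r.
  by have := halfS (k + j)%N; lra.
have [_ dk] := bds k.
have : 0 < binsum b k + 2^-1 ^+ k - t by rewrite subr_gt0.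
move: half_cvg0 => /cvgrPdist_lt h /h[M _ /(_ (k + M)%N (leq_addl _ _))].
rewrite /= sub0r normrN ger0_norm ?ltW// => hM.
by have [+ _] := bds (k + M)%N; rewrite Sk; move: hM; lra.
Qed.

Lemma binary_prefix_ex (s : seq bool) : exists2 t : R, 0 <= t <= 1 &
  exists2 b, binary_expansion t b & mkseq b (size s) = s.
Proof.
(* The default [false] pads the word with zeros, which is the selected expansion of a dyadic number
   below 1. *)
pose b := nth false s.
have Sn n : (size s <= n)%N -> binsum b n = binsum b (size s).
  move=> /subnKC <-; elim: (n - size s)%N => [|j ih]; first by rewrite addn0.
  by rewrite addnS binsumS ih /b nth_default ?leq_addr// mul0r addr0.
exists (binsum b (size s)).
  rewrite binsum_le1 andbT -[leLHS](binsum0 b).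
  exact: binsum_nondecreasing.
exists b; last exact: mkseq_nth.
split; last first.
  move=> _ m; exists (maxn m (size s)); first exact: leq_maxl.
  by rewrite /b nth_default// leq_maxr.
apply: cvg_near_cst; exists (size s) => // n /= sn; exact: Sn.
Qed.

Lemma word_setE t b w : 0 <= t <= 1 -> binary_expansion t b ->
  \1_(word_set w) t = (mkseq b (size w) == w)%:R :> R.
Proof.
move=> t01 bt; rewrite indicE; congr (nat_of_bool _)%:R.
apply/idP/eqP => [|e].
  rewrite inE => -[_ [b' [b't <-]]]; rewrite size_mkseq.
  by apply: eq_map => i; exact: binary_expansion_inj bt b't i.
by rewrite inE; split => //; exists b.
Qed.

End binary.

(** * Paths in the tree and the process along binary expansions *)

Section paths.
Context d (T : measurableType d) {R : realType} (P : probability T R).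
Variable N : seq bool -> {RV P >-> R}.
Variable q : R.
Hypothesis q0 : 0 <= q.

Definition path_value w (b : nat -> bool) n (o : T) : R :=
  \sum_(k < n) q ^+ k * (-1) ^+ b k * N (w ++ mkseq b k) o.

Lemma path_valueS w b n o : path_value w b n.+1 o =
  (-1) ^+ b 0%N * N w o + q * path_value (rcons w (b 0%N)) (b \o succn) n o.
Proof.
rewrite /path_value big_ord_recl expr0 mul1r cats0; congr (_ + _).
rewrite mulr_sumr; apply: eq_bigr => k _.
rewrite exprS !mulrA; congr (_ * N _ o).
rewrite cat_rcons; congr (_ ++ _).
by rewrite /mkseq -[iota 0 (lift _ _)]/(0%N :: iota 1 k)/= -[1%N]/(1 + 0)%N iotaDl -map_comp.
Qed.

Lemma eq_path_value w b b' n o : (forall i, (i < n)%N -> b i = b' i) ->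
  path_value w b n o = path_value w b' n o.
Proof.
move=> h; apply: eq_bigr => k _; rewrite h//; congr (_ * N (_ ++ _) o).
apply/eq_in_map => i; rewrite mem_iota add0n => ik.
by apply: h; apply: ltn_trans ik _.
Qed.

Lemma path_value_le_tree_max n w b o : path_value w b n o <= tree_max N q n w o.
Proof.
elim: n w b => [|n ih] w b; first by rewrite /path_value big_ord0.
rewrite path_valueS /= /max_comb le_max.
have := ih (rcons w (b 0%N)) (b \o succn).
case: (b 0%N) => h; rewrite ?expr1 ?mulN1r ?expr0 ?mul1r.
  by rewrite [X in _ || X]lerD2l [X in _ || X]ler_wpM2l// orbT.
by rewrite lerD2l ler_wpM2l.
Qed.

Lemma path_value_tree_max n w o :
  exists b, path_value w b n o = tree_max N q n w o.
Proof.
elim: n w => [|n ih] w; first by exists (fun=> false); rewrite /path_value big_ord0.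
have [b0 e0] := ih (rcons w false); have [b1 e1] := ih (rcons w true).
rewrite /= /max_comb.
have [_|_] := leP (N w o + q * tree_max N q n (rcons w false) o)
  (- N w o + q * tree_max N q n (rcons w true) o).
  exists (fun i => if i is j.+1 then b1 j else true).
  by rewrite path_valueS /= expr1 mulN1r -e1.
exists (fun i => if i is j.+1 then b0 j else false).
by rewrite path_valueS /= expr0 mul1r -e0.
Qed.

(** At level [k] only the word formed by the first [k] digits of [t] contributes, and the next digit
    gives the sign. *)
Lemma Zproc_path (alpha : R) n t b o : q = Num.sqrt (2 `^ (alpha - 2)) ->
  0 <= t <= 1 -> binary_expansion t b ->
  Zproc alpha N n t o = path_value [::] b n o.
Proof.
move=> qE t01 bt; apply: eq_bigr => k _.
(* Both sides are powers of 2, since [q] is 2 to the power [alpha / 2 - 1]. *)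
have ck : (2^-1 : R) `^ ((1 - alpha / 2) * k%:R) = q ^+ k.
  have e x : (2^-1 : R) `^ x = 2 `^ (- x).
    by rewrite -[X in X `^ _](@powR_inv1 _ 2)// -powRrM mulN1r.
  rewrite e qE -powR12_sqrt ?powR_ge0// -powR_mulrn ?powR_ge0// -!powRrM.
  by congr (_ `^ _); field.
pose tb : k.-tuple bool := Tuple (introT eqP (size_mkseq b k)).
have ind (w : k.-tuple bool) c :
    \1_(word_set (rcons w c)) t = ((w == tb) && (b k == c))%:R :> R.
  rewrite (word_setE _ t01 bt) size_rcons size_tuple /mkseq -addn1 iotaD map_cat/=.
  by rewrite cats1 eqseq_rcons add0n -val_eqE/= eq_sym.
rewrite (bigD1 tb)//= big1 ?addr0; last first.
  by move=> w /negbTE wtb; rewrite !ind wtb subrr mulr0 mul0r.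
have ib c := ind tb c; rewrite /= in ib.
rewrite !ib eqxx ck; congr (_ * _ * _).
by case: (b k) => /=; rewrite ?expr0 ?expr1 ?subr0 ?sub0r.
Qed.

(** Every [t] follows some path, and conversely the first [n] digits of an optimal path, which alone
    matter, are those of some [t]. *)
Lemma sup01_Zproc (alpha : R) n : q = Num.sqrt (2 `^ (alpha - 2)) ->
  sup01 (Zproc alpha N n) = tree_max N q n [::] :> (T -> R).
Proof.
move=> qE; apply/funext => o; apply/eqP; rewrite eq_le; apply/andP; split.
  apply: ge_sup.
    by exists (Zproc alpha N n 0 o), 0 => //=; rewrite in_itv/= lexx ler01.
  move=> _ [t + <-]; rewrite /= in_itv/= => t01.
  have [b bt] := binary_expansion_ex t01.
  by rewrite (Zproc_path _ _ qE t01 bt) path_value_le_tree_max.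
have [b <-] := path_value_tree_max n [::] o.
have [t t01 [b' bt' eb]] := @binary_prefix_ex R (mkseq b n).
rewrite size_mkseq in eb.
have -> : path_value [::] b n o = Zproc alpha N n t o.
  rewrite (Zproc_path _ _ qE t01 bt'); apply: eq_path_value => i i_n.
  by have := congr1 (nth false ^~ i) eb; rewrite !nth_mkseq.
apply: ub_le_sup; last by exists t => //=; rewrite in_itv.
exists (tree_max N q n [::] o) => _ [s + <-]; rewrite /= in_itv/= => s01.
have [c cs] := binary_expansion_ex s01.
by rewrite (Zproc_path _ _ qE s01 cs) path_value_le_tree_max.
Qed.

Lemma tree_max_nondecreasing n w o : tree_max N q n w o <= tree_max N q n.+1 w o.
Proof.
elim: n w => [|n ih] w.
  by rewrite /= /max_comb !mulr0 !addr0 le_max oppr_ge0; case: leP => //= /ltW.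
have := path_value_tree_max n.+1 w o.
move: (ih (rcons w false)) (ih (rcons w true)) => h0 h1 _.
rewrite [leLHS]/= [leRHS]/= /max_comb ge_max !le_max.
by rewrite lerD2l ler_wpM2l//= [X in _ || X]lerD2l [X in _ || X]ler_wpM2l// orbT.
Qed.

End paths.

(** * Numerical values *)

Section pi_bounds.
Context {R : realType}.
Implicit Type x : R.

Lemma ge0_from0 (f df : R -> R) : (forall x : R, is_derive x 1 f (df x)) ->
  (forall x, 0 <= x -> 0 <= df x) -> f 0 = 0 -> forall x, 0 <= x -> 0 <= f x.
Proof.
move=> dfdf df0 f0 x x0; rewrite -f0.
apply: (@ger0_derive1_ndecr _ f 0 x) => //.
- move=> z; rewrite in_itv/= => /andP[z0 _].
  by rewrite derive1E derive_val; exact/df0/ltW.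
- by apply: derivable_within_continuous => z _.
Qed.

(** Each of these normalized monomials is the derivative of the next, so Taylor polynomials are
    differentiated by shifting indices. *)
Definition expn_fact n x : R := x ^+ n / n`!%:R.

Lemma is_derive_expn_fact n x : is_derive x 1 (expn_fact n.+1) (expn_fact n x).
Proof.
have -> : expn_fact n.+1 = (n.+1`!%:R)^-1 \*: ((@id R) ^+ n.+1).
  by apply/funext => y; rewrite /expn_fact mulrC /= exprfctE.
apply: is_derive_eq; rewrite /expn_fact /GRing.scale/= mulr1 factS natrM.
by field; rewrite pnatr_eq0 -lt0n fact_gt0/= addrC natr1 pnatr_eq0.
Qed.

Lemma is_derive_expn_fact0 x : is_derive x 1 (expn_fact 0) 0.
Proof.
have -> : expn_fact 0 = cst 1 by apply/funext => y; rewrite /expn_fact expr0 divr1.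
exact: is_derive_cst.
Qed.

(** Alternating Taylor bounds, obtained by integrating [cos <= 1] repeatedly from 0: each inequality
    is the derivative of the next. *)
Lemma cos_sin_taylor : forall x, 0 <= x ->
  0 <= cos x - expn_fact 0 x + expn_fact 2 x - expn_fact 4 x + expn_fact 6 x /\
  0 <= expn_fact 0 x - cos x - expn_fact 2 x + expn_fact 4 x - expn_fact 6 x + expn_fact 8 x.
Proof.
have ef0 n : expn_fact n.+1 0 = 0 by rewrite /expn_fact expr0n mul0r.
have ef00 : expn_fact 0 0 = 1 by rewrite /expn_fact expr0 divr1.
have d0 := is_derive_expn_fact0; have dS := is_derive_expn_fact.
have s1 : forall x, 0 <= x -> 0 <= expn_fact 1 x - sin x.
  have D (x : R) : is_derive x 1 (expn_fact 1 - @sin R) (expn_fact 0 x - cos x).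
    by apply: is_derive_eq; lra.
  apply: (ge0_from0 D); last by rewrite !fctE sin0 ef0; lra.
  by move=> y _; rewrite /expn_fact expr0 divr1 subr_ge0 cos_le1.
have c2 : forall x, 0 <= x -> 0 <= cos x - expn_fact 0 x + expn_fact 2 x.
  have D (x : R) : is_derive x 1 (@cos R - expn_fact 0 + expn_fact 2) (expn_fact 1 x - sin x).
    by apply: is_derive_eq; lra.
  by apply: (ge0_from0 D s1); rewrite !fctE cos0 ?ef0 ?ef00; lra.
have s3 : forall x, 0 <= x -> 0 <= sin x - expn_fact 1 x + expn_fact 3 x.
  have D (x : R) : is_derive x 1 (@sin R - expn_fact 1 + expn_fact 3) (cos x - expn_fact 0 x + expn_fact 2 x).
    by apply: is_derive_eq; lra.
  by apply: (ge0_from0 D c2); rewrite !fctE sin0 ?ef0 ?ef00; lra.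
have c4 : forall x, 0 <= x -> 0 <= expn_fact 0 x - cos x - expn_fact 2 x + expn_fact 4 x.
  have D (x : R) : is_derive x 1 (expn_fact 0 - @cos R - expn_fact 2 + expn_fact 4) (sin x - expn_fact 1 x + expn_fact 3 x).
    by apply: is_derive_eq; lra.
  by apply: (ge0_from0 D s3); rewrite !fctE cos0 ?ef0 ?ef00; lra.
have s5 : forall x, 0 <= x -> 0 <= expn_fact 1 x - sin x - expn_fact 3 x + expn_fact 5 x.
  have D (x : R) : is_derive x 1 (expn_fact 1 - @sin R - expn_fact 3 + expn_fact 5) (expn_fact 0 x - cos x - expn_fact 2 x + expn_fact 4 x).
    by apply: is_derive_eq; lra.
  by apply: (ge0_from0 D c4); rewrite !fctE sin0 ?ef0 ?ef00; lra.
have c6 : forall x, 0 <= x -> 0 <= cos x - expn_fact 0 x + expn_fact 2 x - expn_fact 4 x + expn_fact 6 x.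
  have D (x : R) : is_derive x 1 (@cos R - expn_fact 0 + expn_fact 2 - expn_fact 4 + expn_fact 6) (expn_fact 1 x - sin x - expn_fact 3 x + expn_fact 5 x).
    by apply: is_derive_eq; lra.
  by apply: (ge0_from0 D s5); rewrite !fctE cos0 ?ef0 ?ef00; lra.
have s7 : forall x, 0 <= x -> 0 <= sin x - expn_fact 1 x + expn_fact 3 x - expn_fact 5 x + expn_fact 7 x.
  have D (x : R) : is_derive x 1 (@sin R - expn_fact 1 + expn_fact 3 - expn_fact 5 + expn_fact 7) (cos x - expn_fact 0 x + expn_fact 2 x - expn_fact 4 x + expn_fact 6 x).
    by apply: is_derive_eq; lra.
  by apply: (ge0_from0 D c6); rewrite !fctE sin0 ?ef0 ?ef00; lra.
have c8 : forall x, 0 <= x -> 0 <= expn_fact 0 x - cos x - expn_fact 2 x + expn_fact 4 x - expn_fact 6 x + expn_fact 8 x.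
  have D (x : R) : is_derive x 1 (expn_fact 0 - @cos R - expn_fact 2 + expn_fact 4 - expn_fact 6 + expn_fact 8) (sin x - expn_fact 1 x + expn_fact 3 x - expn_fact 5 x + expn_fact 7 x).
    by apply: is_derive_eq; lra.
  by apply: (ge0_from0 D s7); rewrite !fctE cos0 ?ef0 ?ef00; lra.
by move=> x x0; split; [exact: c6|exact: c8].
Qed.

Lemma cos_taylor x : 0 <= x ->
  [/\ 1 - x ^+ 2 / 2 + x ^+ 4 / 24 - x ^+ 6 / 720 <= cos x &
      cos x <= 1 - x ^+ 2 / 2 + x ^+ 4 / 24 - x ^+ 6 / 720 + x ^+ 8 / (56 * 720)].
Proof.
have f8 : 8`!%:R = 56 * 720 :> R by rewrite -natrM.
move=> /cos_sin_taylor; rewrite /expn_fact f8 !factS fact0 expr0 !muln1 divr1.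
rewrite -[(4 * _)%N]/24%N -[(6 * _)%N]/720%N.
by case=> h1 h2; split; lra.
Qed.

(** The cosine decreases on [[0, pi]] and vanishes at [pi / 2], so the signs of its Taylor bounds at
    the halved candidates decide. The bound [2 <= pi] places these points in the interval, and the
    precision is what [numeric_bounds] consumes. *)
Lemma pi_bounds : 3 + 139 / 1000 < (pi : R) < 3 + 142 / 1000.
Proof.
have pi2 := @pi_ge2 R.
have pihalf : (pi / 2 : R) \in `[0, pi].
  by rewrite in_itv/= divr_ge0 ?pi_ge0//= ler_pdivrMr// ler_peMr ?pi_ge0// ler1n.
have inpi x : 0 <= x <= 2 -> x \in `[0, (pi : R)].
  by rewrite in_itv/= => /andP[-> /le_trans]; exact.
apply/andP; split.
  have /cos_taylor[h _] : 0 <= (3 + 139 / 1000) / 2 :> R by lra.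
  have : cos (pi / 2) < cos ((3 + 139 / 1000) / 2 : R).
    by rewrite cos_pihalf; apply: lt_le_trans h; lra.
  rewrite ltr_cos//; first by lra.
  by apply: inpi; lra.
have /cos_taylor[_ h] : 0 <= (3 + 142 / 1000) / 2 :> R by lra.
have : cos ((3 + 142 / 1000) / 2 : R) < cos (pi / 2).
  by rewrite cos_pihalf; apply: le_lt_trans h _; lra.
rewrite ltr_cos//; first by lra.
by apply: inpi; lra.
Qed.

Lemma lt_of_expn n (x y : R) : 0 <= y -> x ^+ n.+1 < y ^+ n.+1 -> x < y.
Proof.
move=> y0 h; rewrite ltNge; apply/negP => yx.
by move: h; rewrite ltNge lerXn2r// nnegrE// (le_trans y0).
Qed.

Lemma le_of_expn n (x y : R) : 0 <= y -> x ^+ n.+1 <= y ^+ n.+1 -> x <= y.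
Proof.
move=> y0 h; rewrite leNgt; apply/negP => yx.
by move: h; rewrite leNgt ltrXn2r// nnegrE ltW.
Qed.

Lemma sqr_lt (x y : R) : 0 <= x -> x < y -> x ^+ 2 < y ^+ 2.
Proof. by move=> x0 xy; rewrite ltrXn2r// nnegrE// (le_trans x0) ?ltW. Qed.

(* The long numerals are split because numerals of [R] go through unary [nat]. *)
Lemma numeric_bounds (kappa : R) : kappa = 2 `^ (1 / 2 - 2) ->
  (1968%:R / 1000%:R <= Num.sqrt 2 / (Num.sqrt pi * (1 - Num.sqrt kappa)) < 1969%:R / 1000%:R) /\
  (2613%:R / 1000%:R <= Num.sqrt (2 / (1 - 2 * kappa)) < 2614%:R / 1000%:R).
Proof.
move=> kE.
have k0 : 0 < kappa by rewrite kE powR_gt0.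
(* [kappa] is 2 to the power [-3/2]; this equation, and [s ^+ 4 = 1 / 8] below, reduce decimal
   bounds to comparing powers of rationals. *)
have k2 : kappa ^+ 2 = 1 / 8.
  rewrite -powR_mulrn ?(ltW k0)// kE -powRrM (_ : _ * _ = - 3%:R); last by field.
  by rewrite powRN powR_mulrn//; field.
have kb1 : (353 * 1000 + 553) / 10 ^+ 6 < kappa.
  by apply: (@lt_of_expn 1); [exact: ltW|rewrite k2; clear; lra].
have kb2 : kappa < (353 * 1000 + 554) / 10 ^+ 6.
  by apply: (@lt_of_expn 1); [clear; lra|rewrite k2; clear; lra].
set s := Num.sqrt kappa.
have s0 : 0 <= s by exact: sqrtr_ge0.
have s2 : s ^+ 2 = kappa by rewrite sqr_sqrtr// ltW.
have s4 : s ^+ 4 = 1 / 8 by rewrite (exprM s 2 2) s2.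
have sb1 : (594 * 1000 + 602) / 10 ^+ 6 < s.
  by apply: (@lt_of_expn 3) => //; rewrite s4; clear; lra.
have sb2 : s < ((594 * 1000 + 603) * 10 + 6) / 10 ^+ 7.
  by apply: (@lt_of_expn 3); [clear; lra|rewrite s4; clear; lra].
have /andP[p1 p2] := pi_bounds.
have pi0 : 0 < pi :> R by exact: pi_gt0.
have sp0 : 0 < Num.sqrt pi :> R by rewrite sqrtr_gt0.
have ms0 : 0 < 1 - s by clear - sb2; lra.
have sp2 : (Num.sqrt pi) ^+ 2 = pi :> R by rewrite sqr_sqrtr// ltW.
have st0 : 0 <= Num.sqrt 2 :> R by exact: sqrtr_ge0.
have st2 : (Num.sqrt 2) ^+ 2 = 2 :> R by rewrite sqr_sqrtr.
have den0 : 0 < Num.sqrt pi * (1 - s) by rewrite mulr_gt0.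
have ms1 : (1 - s) ^+ 2 < ((405 * 1000 + 398) / 10 ^+ 6) ^+ 2.
  by apply: sqr_lt; [exact: ltW|clear - sb1; lra].
have ms2 : (((405 * 1000 + 396) * 10 + 4) / 10 ^+ 7) ^+ 2 < (1 - s) ^+ 2.
  by apply: sqr_lt; clear - sb2; lra.
set den := Num.sqrt pi * (1 - s) in den0 *.
have den2 : den ^+ 2 = pi * (1 - s) ^+ 2 by rewrite exprMn sp2.
have up : pi * (1 - s) ^+ 2 <= (3 + 142 / 1000) * ((405 * 1000 + 398) / 10 ^+ 6) ^+ 2.
  by apply: ler_pM; [exact: ltW|exact: sqr_ge0|exact: ltW|exact: ltW].
have dn : (3 + 139 / 1000) * (((405 * 1000 + 396) * 10 + 4) / 10 ^+ 7) ^+ 2 <= pi * (1 - s) ^+ 2.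
  by apply: ler_pM; [clear; lra|exact: sqr_ge0|exact: ltW|exact: ltW].
have a2 : (Num.sqrt 2 / den) ^+ 2 = 2 / den ^+ 2 by rewrite expr_div_n st2.
have den20 : 0 < den ^+ 2 by rewrite exprn_gt0.
have a0 : 0 <= Num.sqrt 2 / den by rewrite divr_ge0// ltW.
have d0 : 0 < 1 - 2 * kappa by clear - kb2; lra.
have b0 := sqrtr_ge0 (2 / (1 - 2 * kappa)).
have b2 : Num.sqrt (2 / (1 - 2 * kappa)) ^+ 2 = 2 / (1 - 2 * kappa).
  by rewrite sqr_sqrtr// divr_ge0// ltW.
split; apply/andP; split.
- by apply: (@le_of_expn 1) => //; rewrite a2 ler_pdivlMr// den2; clear - up; lra.
- by apply: (@lt_of_expn 1); [clear; lra|rewrite a2 ltr_pdivrMr// den2; clear - dn; lra].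
- by apply: (@le_of_expn 1) => //; rewrite b2 ler_pdivlMr//; clear - kb1; lra.
- by apply: (@lt_of_expn 1); [clear; lra|rewrite b2 ltr_pdivrMr//; clear - kb2; lra].
Qed.

End pi_bounds.

(** * Tails and the limit *)

Section limits.
Context d (T : measurableType d) {R : realType} (P : probability T R).

(** The bounds [c] may vary with [n], because the exponential moment bounds involve the mean of
    [S_n], which converges to that of [S]. *)
Lemma fatou_ae_le (f_ : (T -> R)^nat) (f : T -> R) (c : R^nat) (l : R) :
  (forall n, measurable_fun setT (f_ n)) -> measurable_fun setT f ->
  (forall n x, 0 <= f_ n x) -> (forall x, 0 <= f x) ->
  {ae P, forall x, f_ ^~ x @ \oo --> f x} ->
  (forall n, (\int[P]_x (f_ n x)%:E <= (c n)%:E)%E) -> c @ \oo --> l ->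
  (\int[P]_x (f x)%:E <= l%:E)%E.
Proof.
move=> mf_ mf f_0 f0 [M [mM M0 sM]] fc cl.
have mD : measurable (~` M) by exact: measurableC.
have mfE n : measurable_fun (~` M) (fun x => (f_ n x)%:E).
  by apply: measurable_funTS; exact/measurable_EFinP.
(* Off the null set [M] the convergence holds everywhere, and Fatou's lemma is applied there. *)
rewrite (ge0_negligible_integral mM measurableT)//; last 2 first.
- exact/measurable_EFinP.
- by move=> x _; rewrite lee_fin.
rewrite setTD.
have -> : (\int[P]_(x in ~` M) (f x)%:E =
    \int[P]_(x in ~` M) limn_einf (fun n => (f_ n x)%:E))%E.
  apply: eq_integral => x; rewrite inE => Mx.
  have fx : (fun n => (f_ n x)%:E) @ \oo --> (f x)%:E.
    by apply/fine_cvgP; split; [exact: nearW|apply: contrapT => h; apply: Mx; exact: sM].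
  by have [-> _] := cvg_limn_einf_sup fx.
apply: le_trans (fatou P mD mfE _) _; first by move=> n x _; rewrite lee_fin.
have cE : (fun n => (c n)%:E) @ \oo --> l%:E.
  by apply/fine_cvgP; split => //; exact: nearW.
have [<- _] := cvg_limn_einf_sup cE.
rewrite !limn_einf_lim; apply: lee_lim; [exact: is_cvg_einfs|exact: is_cvg_einfs|].
apply: nearW => n; apply: le_ereal_inf_tmp => _ [k /= nk <-].
apply: le_trans (ereal_inf_lbound _) _; first by exists k.
apply: le_trans (fc k); apply: ge0_subset_integral => //.
- exact/measurable_EFinP.
- by move=> x _; rewrite lee_fin.
Qed.

Lemma measurable_set_le (f g : T -> R) : measurable_fun setT f ->
  measurable_fun setT g -> measurable [set w | f w <= g w].
Proof. by move=> mf mg; have := measurable_fun_le measurableT mf mg; rewrite setTI. Qed.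

Lemma exponential_markov (h : T -> R) (a : R) : measurable_fun setT h ->
  (P [set w : T | (a <= h w)%R] <= (expR (- a))%:E * \int[P]_w (expR (h w))%:E)%E.
Proof.
move=> mh.
have mE : measurable [set w : T | (a <= h w)%R].
  exact: (measurable_set_le (measurable_cst a)).
have me : measurable_fun setT (fun w => (expR (h w))%:E).
  by apply/measurable_EFinP; exact: measurableT_comp.
rewrite -ge0_integralZl//.
rewrite -[X in P X]setIT -integral_indic//.
apply: ge0_le_integral => //.
- exact/measurable_EFinP.
- exact: measurable_funeM.
- move=> w _; rewrite -EFinM lee_fin -expRD indicE.
  case: (boolP (w \in _)) => [|_]; last exact: expR_ge0.
  rewrite inE/= => aw; rewrite -[leLHS]expR0 ler_expR; lra.
Qed.

(** Chernoff's bound with the optimal exponents [l = t / V] and [l = - (t / V)], one for each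
    side. *)
Lemma subgaussian_tail (Y : T -> R) (m V t : R) : 0 < V -> measurable_fun setT Y ->
  (forall l, (\int[P]_w (expR (l * Y w))%:E <= (expR (l * m + l ^+ 2 * V / 2))%:E)%E) ->
  0 < t -> (P [set w : T | (t <= `|Y w - m|)%R] <= (2 * expR (- (t ^+ 2 / (2 * V))))%:E)%E.
Proof.
move=> V0 mY mgf t0.
(* Written without division by [l], one statement covers both tails: at [l = t / V] the event is
   [t <= Y - m], at the opposite value it is [t <= m - Y]. *)
have side l : (P [set w : T | (l * m + t ^+ 2 / V <= l * Y w)%R] <=
    (expR (- (t ^+ 2 / V) + l ^+ 2 * V / 2))%:E)%E.
  have mlY : measurable_fun setT (fun w => l * Y w) by exact: measurable_funM.
  apply: le_trans (exponential_markov _ mlY) _.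
  have e0 : (0 <= (expR (- (l * m + t ^+ 2 / V)))%:E)%E by rewrite lee_fin expR_ge0.
  apply: le_trans (lee_wpmul2l e0 (mgf l)) _.
  by rewrite -EFinM -expRD lee_fin ler_expR; lra.
have mS l : measurable [set w : T | (l * m + t ^+ 2 / V <= l * Y w)%R].
  by apply: (measurable_set_le (measurable_cst _)); exact: measurable_funM.
have mA : measurable [set w : T | (t <= `|Y w - m|)%R].
  apply: (measurable_set_le (measurable_cst _)); apply: measurableT_comp => //.
  exact: measurable_funB.
have eV : t ^+ 2 / V = t / V * t by field; rewrite gt_eqF.
have l0 : 0 < t / V by rewrite divr_gt0.
apply: (@le_trans _ _ (P ([set w : T | ((t / V) * m + t ^+ 2 / V <= (t / V) * Y w)%R] `|`
   [set w : T | ((- (t / V)) * m + t ^+ 2 / V <= (- (t / V)) * Y w)%R]))).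
  apply: le_measure; rewrite ?inE//; first exact: measurableU.
  move=> w /=; rewrite ler_normr => /orP[h|h]; [left|right]; rewrite /= eV.
    by rewrite -mulrDr ler_pM2l//; lra.
  by rewrite !mulNr addrC -mulrBr -mulrN ler_pM2l//; lra.
apply: le_trans (measureU2 _ _ _) _ => //.
rewrite mulrDl mul1r EFinD.
have -> : - (t ^+ 2 / (2 * V)) = - (t ^+ 2 / V) + (t / V) ^+ 2 * V / 2.
  by field; rewrite gt_eqF.
by apply: leeD; [|rewrite -(sqrrN (t / V))]; exact: side.
Qed.

End limits.

(** * Convergence of suprema and the logarithmic rate *)

Section asymptotics.
Context {R : realType}.

(** The supremum is 1-Lipschitz for the uniform distance. Upper bounds make [sup] a least upper
    bound; [f] inherits one from a nearby [f_ n]. *)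
Lemma sup01_uniform_cvg (f_ : nat -> R -> R) (f : R -> R) :
  (forall n, exists M, forall t, 0 <= t <= 1 -> f_ n t <= M) ->
  {uniform `[0, 1]%classic, f_ @ \oo --> f} ->
  sup [set f_ n t | t in `[0, 1]%classic] @[n --> \oo] --> sup [set f t | t in `[0, 1]%classic].
Proof.
move=> fb fcvg; apply/cvgrPdist_le => e e0.
have near_f : \forall n \near \oo, forall t, 0 <= t <= 1 -> `|f t - f_ n t| < e.
  apply: (fcvg [set h : R -> R | forall t, 0 <= t <= 1 -> `|f t - h t| < e]).
  apply/(@uniform_nbhs R `[0, 1]%classic R f).
  exists [set xy | `|xy.1 - xy.2| < e]; split.
    by rewrite -entourage_ballE; exists e.
  by move=> h /= hE t t01; apply: hE; rewrite /= in_itv.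
have sup_le (g h : R -> R) : (exists M, forall t, 0 <= t <= 1 -> h t <= M) ->
    (forall t, 0 <= t <= 1 -> g t <= h t + e) ->
    sup [set g t | t in `[0, 1]%classic] <= sup [set h t | t in `[0, 1]%classic] + e.
  move=> [M hM] gh; apply: ge_sup.
    by exists (g 0), 0 => //=; rewrite in_itv/= lexx ler01.
  move=> _ [t + <-]; rewrite /= in_itv/= => t01.
  apply: le_trans (gh t t01) _; rewrite lerD2r; apply: ub_le_sup.
    by exists M => _ [s + <-]; rewrite /= in_itv/=; exact: hM.
  by exists t => //=; rewrite in_itv.
near=> n.
have h : forall t, 0 <= t <= 1 -> `|f t - f_ n t| < e by near: n.
have [M fM] := fb n.
rewrite ler_distl; apply/andP; split.
  rewrite lerBlDr; apply: sup_le.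
    exists (M + e) => t t01; have := h t t01; have := fM t t01.
    by rewrite ltr_distl => ? /andP[? ?]; lra.
  by move=> t t01; have := h t t01; rewrite ltr_distl => /andP[? ?]; lra.
apply: sup_le; first by exists M.
by move=> t t01; have := h t t01; rewrite ltr_distl => /andP[? ?]; lra.
Unshelve. all: by end_near. Qed.

Definition geom_sum (k : R) n := \sum_(i < n) k ^+ i.

Lemma geom_sum_gt0 k n : 0 <= k -> 0 < geom_sum k n.+1.
Proof.
move=> k0; rewrite /geom_sum big_ord_recl expr0 ltr_wpDr//.
by apply: sumr_ge0 => i _; rewrite exprn_ge0.
Qed.

(** The geometric sums increase to [1 / (1 - k)], so a tree of finite depth attains the optimal rate
    up to [e]. *)
Lemma geom_sum_inv (k e : R) : 0 <= k < 1 -> 0 < e ->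
  exists n, (geom_sum k n.+1)^-1 <= 1 - k + e.
Proof.
move=> /andP[k0 k1] e0.
have cv : series (geometric 1 k) n @[n --> \oo] --> 1 / (1 - k).
  by apply: cvg_geometric_series; rewrite ger0_norm.
have cvi : (series (geometric 1 k) n)^-1 @[n --> \oo] --> 1 - k.
  rewrite -[X in _ --> X]invrK; apply: cvgV; last by rewrite -div1r.
  by rewrite invr_neq0// gt_eqF// subr_gt0.
move/cvgrPdist_le : cvi => /(_ e e0)[M _ /(_ M.+1 (leqnSn M))].
rewrite /= ler_distl => /andP[h _]; exists M.
have -> : geom_sum k M.+1 = series (geometric 1 k) M.+1.
  rewrite /geom_sum /series/= big_mkord; apply: eq_bigr => i _.
  by rewrite mul1r.
move: h; lra.
Qed.

Lemma gaussian_rate (p : R -> R) (k m lp : R) : 0 <= k < 1 -> 0 <= m ->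
  (forall t, 0 < t -> p t <= 2 * expR (- ((1 - k) / 2 * t ^+ 2))) ->
  (forall n t, 0 < t -> expR (n.+1%:R * lp - ((t + m) ^+ 2 / geom_sum k n.+1 +
      2 * n.+1%:R * ((t + m) / geom_sum k n.+1) + n.+1%:R) / 2) <= p t) ->
  t ^- 2 * ln (p t) @[t --> +oo%R] --> - ((1 - k) / 2).
Proof.
move=> k01 m0 up dn; apply/cvgrPdist_le => e e0.
(* The depth [n] is fixed before [t] grows. The leading term [s / 2] then exceeds [(1 - k) / 2] by
   at most [e / 2], and the other half of [e] pays for the terms of lower order. *)
have [n sn] := geom_sum_inv k01 e0.
have /andP[k0 k1] := k01.
have s0 : 0 < (geom_sum k n.+1)^-1 by rewrite invr_gt0 geom_sum_gt0.
move: (dn n) sn s0; set s := (geom_sum k n.+1)^-1; set N := n.+1%:R => dn' sn s0.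
have N0 : 0 <= N by rewrite ler0n.
(* [K] collects the coefficients of all lower-order terms of the lower bound; the final 1 absorbs
   the [ln 2] of the upper bound. *)
pose K := `|N * lp - N / 2| + (2 * m + m ^+ 2) * s + N * (1 + m) * s + 1.
have K0 : 1 <= K.
  rewrite lerDr addr_ge0// ?addr_ge0// mulr_ge0 ?(ltW s0)// ?addr_ge0 ?mulr_ge0 ?sqr_ge0//.
  by rewrite addr_ge0.
near=> t.
have t1 : 1 <= t by near: t; apply: nbhs_pinfty_ge; rewrite num_real.
have t0 : 0 < t by apply: lt_le_trans t1.
have tK : 2 * K / e <= t by near: t; apply: nbhs_pinfty_ge; rewrite num_real.
pose r := t^-1.
have r0 : 0 < r by rewrite invr_gt0.
have r1 : r <= 1 by rewrite invf_le1.
have rt : r * t = 1 by rewrite mulVf// gt_eqF.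
have rK : K * r <= e / 2.
  rewrite ler_pdivlMr// mulrAC ler_pdivrMr// mulrC.
  by move: tK; rewrite ler_pdivrMr// (mulrC 2) [e * t]mulrC.
have rr : r ^+ 2 <= r by rewrite expr2 ler_piMl// ltW.
have r20 : 0 <= r ^+ 2 by rewrite sqr_ge0.
have p0 : 0 < p t by apply: lt_le_trans (dn' t t0); exact: expR_gt0.
have -> : t ^- 2 = r ^+ 2 by rewrite exprVn.
have upl : ln (p t) <= ln 2 - (1 - k) / 2 * t ^+ 2.
  have := up t t0; rewrite -ler_ln ?posrE ?mulr_gt0 ?expR_gt0// lnM ?posrE ?expR_gt0//.
  by rewrite expRK.
have dnl : N * lp - ((t + m) ^+ 2 * s + 2 * N * ((t + m) * s) + N) / 2 <= ln (p t).
  by have := dn' t t0; rewrite -{1}(lnK p0) ler_expR.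
have ln2 : ln 2 <= 1 :> R.
  by rewrite (_ : 2 = 1 + 1)// le_ln1Dx//; lra.
have U : r ^+ 2 * ln (p t) <= r - (1 - k) / 2.
  apply: le_trans (ler_wpM2l r20 upl) _.
  have -> : r ^+ 2 * (ln 2 - (1 - k) / 2 * t ^+ 2) =
    r ^+ 2 * ln 2 - (1 - k) / 2 * (r * t) ^+ 2 by ring.
  rewrite rt expr1n mulr1 lerD2r; apply: le_trans rr.
  by rewrite ler_piMr.
have L : - (s / 2) - K * r <= r ^+ 2 * ln (p t).
  apply: le_trans (ler_wpM2l r20 dnl).
  have -> : r ^+ 2 * (N * lp - ((t + m) ^+ 2 * s + 2 * N * ((t + m) * s) + N) / 2) =
    r ^+ 2 * (N * lp - N / 2) - (r * t + m * r) ^+ 2 * s / 2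
    - N * (r * (r * t + m * r)) * s by field.
  rewrite rt.
  have a1 : - (`|N * lp - N / 2| * r) <= r ^+ 2 * (N * lp - N / 2).
    rewrite lerNl -mulrN; apply: le_trans (ler_norm _) _.
    rewrite normrM normrN (ger0_norm r20) mulrC.
    by rewrite ler_wpM2l.
  have a2 : (1 + m * r) ^+ 2 * s / 2 <= s / 2 + (2 * m + m ^+ 2) * s * r.
    have -> : (1 + m * r) ^+ 2 * s / 2 = s / 2 + (2 * m * r + m ^+ 2 * r ^+ 2) * s / 2 by ring.
    rewrite lerD2l.
    have b1 : 2 * m * r + m ^+ 2 * r ^+ 2 <= (2 * m + m ^+ 2) * r.
      have -> : (2 * m + m ^+ 2) * r = 2 * m * r + m ^+ 2 * r by ring.
      by rewrite lerD2l ler_wpM2l// sqr_ge0.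
    have b2 : (2 * m * r + m ^+ 2 * r ^+ 2) * s <= (2 * m + m ^+ 2) * s * r.
      by rewrite [leRHS]mulrAC ler_wpM2r// ltW.
    have b3 : 0 <= (2 * m + m ^+ 2) * s * r.
      by rewrite !mulr_ge0 ?(ltW s0) ?(ltW r0)// addr_ge0 ?sqr_ge0// mulr_ge0.
    lra.
  have a3 : N * (r * (1 + m * r)) * s <= N * (1 + m) * s * r.
    rewrite (_ : N * (1 + m) * s * r = N * s * r * (1 + m)); last by ring.
    rewrite (_ : N * (r * (1 + m * r)) * s = N * s * r * (1 + m * r)); last by ring.
    by rewrite ler_wpM2l ?mulr_ge0 ?(ltW s0) ?(ltW r0)// lerD2l ler_piMr.
  have -> : K * r = `|N * lp - N / 2| * r + (2 * m + m ^+ 2) * s * r +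
    N * (1 + m) * s * r + r by rewrite /K; ring.
  lra.
have Kr : r <= K * r by rewrite ler_peMl// ltW.
by rewrite ler_distl; apply/andP; split; lra.
Unshelve. all: by end_near. Qed.

End asymptotics.

(** * Lower bounds for the upper tail of the maximum *)

Section lower_tail.
Context d (T : measurableType d) {R : realType} (P : probability T R).
Variable N : seq bool -> {RV P >-> R}.
Hypothesis N_indep : mutually_independent N.
Hypothesis N_normal : forall w, standard_normal (N w).
Variable q : R.
Hypothesis q01 : 0 <= q < 1.
Local Notation lp := (ln (normal_peak (1 : R))).

(** On the unit interval from [c] to [c + 1] the density is at least its value at the right end. *)
Lemma node_tail_ge w (c : R) : 0 <= c ->
  ((expR (lp - (c + 1) ^+ 2 / 2))%:E <= P (N w @^-1` [set x : R | (c <= x)%R]))%E.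
Proof.
move=> c0.
have mc : measurable [set x : R | c <= x].
  by rewrite -set_itvcy; exact: measurable_itv.
have := N_normal w mc; rewrite /distribution /pushforward => ->.
rewrite /normal_prob.
have mphi (D : set R) : measurable D ->
    measurable_fun D (fun x : R => (normal_pdf 0 1 x)%:E).
  by move=> mD; apply: measurable_funTS; apply/measurable_EFinP; exact: measurable_normal_pdf.
apply: (@le_trans _ _ (\int[lebesgue_measure]_(x in `[c, (c + 1)%R]) (normal_pdf 0 1 x)%:E)%E).
  apply: (@le_trans _ _ (\int[lebesgue_measure]_(x in `[c, (c + 1)%R])
      (expR (lp - (c + 1) ^+ 2 / 2))%:E)%E).
    rewrite integral_cst//= lebesgue_measure_itv/= lte_fin ltrDl ltr01.
    by rewrite -EFinB addrAC subrr add0r mule1.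
  apply: ge0_le_integral => //.
  - exact: mphi.
  - move=> x; rewrite /= in_itv/= => /andP[cx xc]; rewrite lee_fin std_pdfE ler_expR.
    rewrite lerD2l lerN2 ler_pM2r ?invr_gt0// ler_sqr ?nnegrE//.
      exact: le_trans cx.
    by rewrite addr_ge0.
apply: ge0_subset_integral => //.
- exact: mphi.
- by move=> x _; rewrite lee_fin normal_pdf_ge0.
- by move=> x; rewrite /= in_itv/= => /andP[].
Qed.

Lemma tree_max_tail_ge n (u : R) : 0 <= u ->
  ((expR (n.+1%:R * lp - (u ^+ 2 / geom_sum (q ^+ 2) n.+1 +
      2 * n.+1%:R * (u / geom_sum (q ^+ 2) n.+1) + n.+1%:R) / 2))%:E <=
   P [set o | (u <= tree_max N q n.+1 [::] o)%R])%E.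
Proof.
move=> u0; have /andP[q0 q1] := q01.
set s := geom_sum _ _.
have s0 : 0 < s by apply: geom_sum_gt0; rewrite sqr_ge0.
pose zw i := mkseq (fun=> false) i : seq bool.
(* By Cauchy-Schwarz these thresholds minimize [\sum_i c_i^2] subject to
   [\sum_i q^i c_i = u]. *)
pose c (w : seq bool) := q ^+ size w * (u / s).
have us0 : 0 <= u / s by rewrite divr_ge0// ltW.
have c0 w : 0 <= c w by rewrite mulr_ge0// exprn_ge0.
pose A (w : seq bool) : set R := [set x | c w <= x].
have mA w : measurable (A w).
  by rewrite /A -set_itvcy; exact: measurable_itv.
pose ws := [seq zw i | i <- iota 0 n.+1].
have uws : uniq ws.
  rewrite map_inj_uniq ?iota_uniq// => i j /(congr1 size).
  by rewrite !size_mkseq.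
have mT : measurable [set o | (u <= tree_max N q n.+1 [::] o)%R].
  by apply: (measurable_set_le (measurable_cst u)); exact: measurable_funPT.
apply: (@le_trans _ _ (P [set o | forall w, w \in ws -> A w (N w o)])); last first.
  apply: le_measure; rewrite ?inE//.
    apply: (@cylinders_measurable _ _ _ _ _ N predT).
    by exists ws, A; split => //; exact/allP.
  move=> o /= h; apply: le_trans _ (path_value_le_tree_max N q0 n.+1 [::] (fun=> false) o).
  apply: (@le_trans _ _ (\sum_(i < n.+1) q ^+ i * (q ^+ i * (u / s)))).
    under eq_bigr do rewrite mulrA -exprD addnn -mul2n exprM.
    by rewrite -mulr_suml -/(geom_sum _ _) -/s mulrCA divff ?mulr1// gt_eqF.
  apply: ler_sum => i _; rewrite expr0 mulr1 /= ler_wpM2l ?exprn_ge0//.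
  have := h (zw i); rewrite /A /c /= size_mkseq; apply.
  by apply: map_f; rewrite mem_iota/= add0n.
rewrite N_indep//.
apply: (@le_trans _ _ (\prod_(w <- ws) (expR (lp - (c w + 1) ^+ 2 / 2))%:E)%E); last first.
  elim: ws {uws} => [|w l ih]; first by rewrite !big_nil.
  rewrite !big_cons; apply: lee_pmul => //.
  - by apply: prode_ge0 => v _; rewrite lee_fin expR_ge0.
  - exact: node_tail_ge.
rewrite big_map (_ : iota 0 n.+1 = index_iota 0 n.+1); last by rewrite /index_iota subn0.
rewrite big_mkord prodEFin lee_fin -expR_sum ler_expR.
(* Expanding [(c + 1) ^+ 2], the squares sum to [u ^+ 2 / s], while each linear term is bounded by
   [2 * (u / s)] since [q ^+ i <= 1]. *)
apply: (@le_trans _ _ (\sum_(i < n.+1) (lp - ((q ^+ 2) ^+ i * (u / s) ^+ 2 +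
    2 * (u / s) + 1) / 2))).
  rewrite sumrB sumr_const card_ord -mulr_suml !big_split/= -mulr_suml.
  rewrite !sumr_const !card_ord -/(geom_sum _ _) -/s mulr_natl lerD2l lerN2 ler_pM2r//.
  rewrite (_ : s * (u / s) ^+ 2 = u ^+ 2 / s); last by field; rewrite gt_eqF.
  by rewrite -[X in _ + X + _]mulr_natl; lra.
apply: ler_sum => i _; rewrite lerD2l lerN2 ler_pM2r//.
rewrite /c /zw size_mkseq sqrrD1 mulrC exprMn -exprM mulnC exprM.
have : q ^+ i * (u / s) <= u / s by rewrite ler_piMl// exprn_ile1// ltW.
rewrite -mulr_natl; lra.
Qed.

End lower_tail.

(** * Passage to the limit in the moments *)

Section limit.
Context d (T : measurableType d) {R : realType} (P : probability T R).
Variable N : seq bool -> {RV P >-> R}.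
Hypothesis N_indep : mutually_independent N.
Hypothesis N_normal : forall w, standard_normal (N w).
Variable q : R.
Hypothesis q01 : 0 <= q < 1.
Hypothesis q2 : 2 * q ^+ 2 < 1.
Variable S : {RV P >-> R}.
Local Notation S_ := (fun n => tree_max N q n [::]).
Hypothesis S_lim : {ae P, forall o, (fun n => S_ n o) @ \oo --> S o}.

Let mS : measurable_fun setT S := measurable_funPT S.

Lemma tree_max_le_limit : {ae P, forall o, forall n, S_ n o <= S o}.
Proof.
have /andP[q0 q1] := q01.
apply: filterS S_lim => o So n.
have nd : nondecreasing_seq (fun n => S_ n o).
  by apply/nondecreasing_seqP => k; exact: tree_max_nondecreasing.
have cS : cvg ((fun n => S_ n o) @ \oo) by apply/cvg_ex; exists (S o).
by rewrite -(cvg_lim _ So)//; exact: nondecreasing_cvgn_le.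
Qed.

Lemma second_moment_limit :
  (\int[P]_o ((S o) ^+ 2)%:E <= (2 / (1 - 2 * q ^+ 2))%:E)%E.
Proof.
apply: (@fatou_ae_le _ _ _ P (fun n o => S_ n o ^+ 2) _ (fun=> 2 / (1 - 2 * q ^+ 2))) => //.
- by move=> n; exact: measurable_funX.
- exact: measurable_funX.
- by move=> n x; rewrite sqr_ge0.
- by move=> x; rewrite sqr_ge0.
- by apply: filterS S_lim => o So; rewrite expr2; exact: cvgM.
- by move=> n; exact: second_moment_tree_max.
- exact: cvg_cst.
Qed.

Lemma integrable_limit : P.-integrable setT (EFin \o S).
Proof.
apply/integrableP; split; first exact/measurable_EFinP.
(* The second moment controls the first through [|S| <= 1 + S ^+ 2]. *)
apply: (@le_lt_trans _ _ (\int[P]_o (1 + (S o ^+ 2)%:E))%E).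
  apply: ge0_le_integral => //.
  - by apply: measurableT_comp => //; exact/measurable_EFinP.
  - by apply: emeasurable_funD => //; apply/measurable_EFinP; exact: measurable_funX.
  - move=> o _ /=; rewrite lee_fin -(real_normK (num_real (S o))).
    by have := sqr_ge0 (`|S o| - 1); have := normr_ge0 (S o); nra.
rewrite ge0_integralD//; last 2 first.
- by move=> o _; rewrite lee_fin sqr_ge0.
- by apply/measurable_EFinP; exact: measurable_funX.
rewrite integral_cst//= probability_setT mule1.
by rewrite lte_add_pinfty ?ltry// (le_lt_trans second_moment_limit)// ltry.
Qed.

(** Dominated convergence with [|S|] as majorant, since [0 <= S_n <= S] almost surely. *)
Lemma cvg_mean_tree_max :
  (\int[P]_o (S_ n o)%:E)%E @[n --> \oo] --> (\int[P]_o (S o)%:E)%E.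
Proof.
have dom : {ae P, forall o n, setT o -> (`|(S_ n o)%:E| <= `|(S o)%:E|)%E}.
  apply: filterS tree_max_le_limit => o So n _ /=.
  rewrite lee_fin ger0_norm ?tree_max_ge0//.
  by apply: le_trans (So n) _; exact: ler_norm.
have lim : {ae P, forall o, setT o -> (S_ n o)%:E @[n --> \oo] --> (S o)%:E}.
  apply: filterS S_lim => o So _.
  by apply/fine_cvgP; split => //; exact: nearW.
have mE (X : {RV P >-> R}) : measurable_fun setT (fun o => (X o)%:E).
  by apply/measurable_EFinP; exact: measurable_funPT.
by have [_ _] := dominated_convergence measurableT (fun n => mE (S_ n)) (mE S) lim
  (integrable_abse integrable_limit) dom.
Qed.

Lemma mean_limit_fin : (\int[P]_o (S o)%:E)%E \is a fin_num.
Proof. exact: integrable_fin_num integrable_limit. Qed.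

Lemma mgf_limit l :
  (\int[P]_o (expR (l * S o))%:E <=
    (expR (l * fine (\int[P]_o (S o)%:E) + l ^+ 2 * (1 - q ^+ 2)^-1 / 2))%:E)%E.
Proof.
apply: (@fatou_ae_le _ _ _ P (fun n o => expR (l * S_ n o)) _
  (fun n => expR (l * fine (\int[P]_o (S_ n o)%:E) + l ^+ 2 * (1 - q ^+ 2)^-1 / 2))) => //.
- by move=> n; apply: measurableT_comp => //; exact: measurable_funM.
- by apply: measurableT_comp => //; exact: measurable_funM.
- apply: filterS S_lim => o So.
  apply: (@continuous_cvg _ _ _ _ _ _ (@expR R)); first exact: continuous_expR.
  exact: cvgMr.
- by move=> n; exact: mgf_tree_max.
- apply: (@continuous_cvg _ _ _ _ _ _ (@expR R)); first exact: continuous_expR.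
  apply: cvgD; last exact: cvg_cst.
  apply: cvgMr; apply: fine_cvg.
  by rewrite fineK ?mean_limit_fin//; exact: cvg_mean_tree_max.
Qed.

Lemma mean_lowerE n :
  mean_lower q n = (Num.sqrt 2 / Num.sqrt pi) / (1 - q) * (1 - q ^+ n).
Proof.
have /andP[q0 q1] := q01.
elim: n => [|n ih] /=; first by rewrite expr0 subrr mulr0.
rewrite ih exprS; field.
by rewrite subr_eq0 gt_eqF//= gt_eqF// sqrtr_gt0 pi_gt0.
Qed.

Lemma mean_limit_ge :
  ((Num.sqrt 2 / (Num.sqrt pi * (1 - q)))%:E <= \int[P]_o (S o)%:E)%E.
Proof.
have /andP[q0 q1] := q01.
rewrite -(fineK mean_limit_fin) lee_fin.
have -> : Num.sqrt 2 / (Num.sqrt pi * (1 - q)) =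
    (Num.sqrt 2 / Num.sqrt pi) / (1 - q) * (1 - 0) :> R.
  field; by rewrite subr_eq0 gt_eqF//= gt_eqF// sqrtr_gt0 pi_gt0.
have cq : mean_lower q n @[n --> \oo] -->
    (Num.sqrt 2 / Num.sqrt pi) / (1 - q) * (1 - 0).
  rewrite (_ : mean_lower q = fun n =>
    (Num.sqrt 2 / Num.sqrt pi) / (1 - q) * (1 - q ^+ n)); last first.
    by apply/funext => n; exact: mean_lowerE.
  apply: cvgMr; apply: cvgB; first exact: cvg_cst.
  by apply: cvg_expr; rewrite ger0_norm.
have cS : fine (\int[P]_o (S_ n o)%:E)%E @[n --> \oo] --> fine (\int[P]_o (S o)%:E)%E.
  by apply: fine_cvg; rewrite fineK ?mean_limit_fin//; exact: cvg_mean_tree_max.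
apply: (ler_cvg_to cq cS); apply: nearW => n; rewrite -lee_fin fineK.
  exact: mean_tree_max.
by apply: integrable_fin_num => //; exact: (integrable_tree_max N_normal _ n [::]).
Qed.
End limit.

Lemma kappa_bounds {R : realType} (alpha : R) : alpha <= 1 / 2 ->
  0 < 2 `^ (alpha - 2) /\ 2 * 2 `^ (alpha - 2) < 1.
Proof.
move=> a2; split; first exact: powR_gt0.
rewrite mulrC -ltr_pdivlMr// div1r -powR_inv1//.
rewrite /powR gt_eqF// ltr_expR ltr_pM2r ?ln_gt0//; last by rewrite ltr1n.
clear -a2; lra.
Qed.

Lemma sup01_limit d (T : measurableType d) {R : realType} (P : probability T R)
    (alpha : R) (N : seq bool -> {RV P >-> R}) (Z : R -> T -> R) (S : T -> R) :
  is_limit_process P alpha N Z ->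
  {ae P, forall o, S o = sup01 Z o} ->
  {ae P, forall o,
    (fun n => tree_max N (Num.sqrt (2 `^ (alpha - 2))) n [::] o) @ \oo --> S o}.
Proof.
move=> ZN SE; apply: filterS2 SE ZN => o -> Zo.
rewrite (_ : (fun n => tree_max _ _ _ _ _) = fun n => sup01 (Zproc alpha N n) o); last first.
  by apply/funext => n; rewrite (sup01_Zproc N (sqrtr_ge0 _) n erefl).
apply: (sup01_uniform_cvg _ Zo) => n.
exists (tree_max N (Num.sqrt (2 `^ (alpha - 2))) n [::] o) => t t01.
have [b bt] := binary_expansion_ex t01.
by rewrite (Zproc_path N n o erefl t01 bt) path_value_le_tree_max ?sqrtr_ge0.
Qed.

Lemma expectation_deviation_set d (T : measurableType d) {R : realType}
    (P : probability T R) (X : T -> R) (t : R) :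
  (\int[P]_o (X o)%:E)%E \is a fin_num ->
  [set o | (t%:E <= `|(X o)%:E - 'E_P[X]|)%E] =
  [set o | (t <= `|X o - fine (\int[P]_o (X o)%:E)%E|)%R].
Proof.
by move=> finX; apply/seteqP; split => o; rewrite /= unlock -[in (_ - _)%E](fineK finX) lee_fin.
Qed.

Lemma sqr_mean_le d (T : measurableType d) {R : realType} (P : probability T R)
    (X : {RV P >-> R}) (c : R) : P.-integrable setT (EFin \o X) ->
  (\int[P]_o ((X o) ^+ 2)%:E <= c%:E)%E -> (fine (\int[P]_o (X o)%:E) ^+ 2 <= c)%R.
Proof.
move=> iX Xc; set m := fine _.
have mX2 : measurable_fun setT (fun o => ((X o) ^+ 2)%:E).
  by apply/measurable_EFinP; apply: measurable_funX; exact: measurable_funPT.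
have iX2 : P.-integrable setT (fun o => ((X o) ^+ 2)%:E).
  apply/integrableP; split=> //.
  under eq_integral do rewrite gee0_abs ?lee_fin ?sqr_ge0//.
  by apply: le_lt_trans Xc _; rewrite ltry.
have iZ : P.-integrable setT (fun o => ((2 * m)%:E * (X o)%:E)%E) by exact: integrableZl.
have ic : P.-integrable setT (fun=> (m ^+ 2)%:E) by exact: finite_measure_integrable_cst.
have finX : (\int[P]_o (X o)%:E)%E \is a fin_num by exact: integrable_fin_num iX.
rewrite -lee_fin; apply: le_trans Xc.
(* Integrating [2 * m * X - m ^+ 2 <= X ^+ 2] gives the claim, because the left side has mean
   [m ^+ 2]. *)
have -> : (m ^+ 2)%:E = (\int[P]_o ((2 * m)%:E * (X o)%:E - (m ^+ 2)%:E))%E.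
  rewrite integralB// integralZl// integral_cst//= probability_setT mule1.
  by rewrite -(fineK finX) -/m -EFinM -EFinB; congr (_%:E); ring.
apply: le_integral => //; first exact: integrableB.
by move=> o _; rewrite -EFinM -EFinB lee_fin; have := sqr_ge0 (X o - m); nra.
Qed.

Lemma le_measure_ae d (T : measurableType d) {R : realType} (P : probability T R)
    (A B : set T) : measurable A -> measurable B ->
  {ae P, forall o, A o -> B o} -> (P A <= P B)%E.
Proof.
move=> mA mB [M [mM M0 sM]].
apply: (@le_trans _ _ (P (B `|` M))).
  apply: le_measure; rewrite ?inE//; first exact: measurableU.
  move=> o Ao; have [Bo|nBo] := pselect (B o); [by left|right].
  by apply: sM => /= /(_ Ao).
apply: le_trans (measureU2 _ mB mM) _.
by rewrite -[leRHS]adde0 -M0.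
Qed.

Theorem proposition4p2 (R : realType) (d : measure_display)
    (T : measurableType d) (P : probability T R)
    (alpha kappa : R) (alpha_gt0 : 0 < alpha) (alpha_le : alpha <= 1 / 2)
    (kappaE : kappa = 2 `^ (alpha - 2))
    (N : seq bool -> {RV P >-> R})
    (N_indep : mutually_independent N)
    (N_normal : forall w, standard_normal (N w))
    (Z : R -> T -> R) (Z_lim : is_limit_process P alpha N Z)
    (S : {RV P >-> R}) (SE : {ae P, forall omega, S omega = sup01 Z omega}) :
  (forall t : R, 0 < t ->
    (P [set omega | t%:E <= `|(S omega)%:E - 'E_P[S]|] <=
       (2 * expR (- ((1 - kappa) / 2 * t ^+ 2)))%:E)%E) /\
  (forall (n : nat) (Sn : T -> R), Sn = sup01 (Zproc alpha N n) ->
    forall t : R, 0 < t ->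
    (P [set omega | t%:E <= `|(Sn omega)%:E - 'E_P[Sn]|] <=
       (2 * expR (- ((1 - kappa) / 2 * t ^+ 2)))%:E)%E) /\
  (t ^- 2 *
     ln (fine (P [set omega | (t%:E <= `|(S omega)%:E - 'E_P[S]|)%E]))
   @[t --> +oo%R] --> - ((1 - kappa) / 2)) /\
  ((Num.sqrt 2 / (Num.sqrt pi * (1 - Num.sqrt kappa)))%:E <= 'E_P[S])%E /\
  ('E_P[S] <= (Num.sqrt (2 / (1 - 2 * kappa)))%:E)%E /\
  ('V_P[S] <= (1 / (1 - kappa))%:E)%E /\
  (alpha = 1 / 2 ->
    exists a b : R,
      [/\ a = Num.sqrt 2 / (Num.sqrt pi * (1 - Num.sqrt kappa)),
          b = Num.sqrt (2 / (1 - 2 * kappa)),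
          1968%:R / 1000%:R <= a < 1969%:R / 1000%:R,
          2613%:R / 1000%:R <= b < 2614%:R / 1000%:R &
          (a%:E <= 'E_P[S] <= b%:E)%E]).
Proof.
have [k0 k2] := kappa_bounds alpha_le; rewrite -kappaE in k0 k2.
have S_lim := sup01_limit Z_lim SE.
set q := Num.sqrt kappa; rewrite -kappaE -/q in S_lim.
have qk : q ^+ 2 = kappa by rewrite sqr_sqrtr// ltW.
have q01 : 0 <= q < 1.
  rewrite sqrtr_ge0 /= -(@ltr_sqr _ q 1) ?nnegrE ?sqrtr_ge0// qk expr1n.
  by clear -k0 k2; lra.
have q2 : 2 * q ^+ 2 < 1 by rewrite qk.
have V0 : 0 < (1 - q ^+ 2)^-1 by rewrite invr_gt0 qk; clear -k0 k2; lra.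
have SnE n : sup01 (Zproc alpha N n) = tree_max N q n [::] :> (T -> R).
  by apply: sup01_Zproc; rewrite ?sqrtr_ge0 /q ?kappaE.
have finS := mean_limit_fin N_indep N_normal q01 q2 S_lim.
have mgfS := mgf_limit N_indep N_normal q01 q2 S_lim.
have ES : ('E_P[S] = \int[P]_o (S o)%:E)%E by rewrite unlock.
have tailE (Y : T -> R) (t : R) : measurable_fun setT Y ->
    (\int[P]_o (Y o)%:E)%E \is a fin_num ->
    (forall l, (\int[P]_o (expR (l * Y o))%:E <=
      (expR (l * fine (\int[P]_o (Y o)%:E) + l ^+ 2 * (1 - q ^+ 2)^-1 / 2))%:E)%E) ->
    0 < t -> (P [set o | t%:E <= `|(Y o)%:E - 'E_P[Y]|] <=
      (2 * expR (- ((1 - kappa) / 2 * t ^+ 2)))%:E)%E.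
  move=> mY finY mgfY t0; rewrite expectation_deviation_set//.
  have := subgaussian_tail V0 mY mgfY t0.
  congr (_ <= (2 * expR (- _))%:E)%E.
  rewrite qk; field.
  by clear -k0 k2; apply: lt0r_neq0; lra.
have tailS t : 0 < t -> _ := tailE S t (measurable_funPT S) finS mgfS.
have lower := mean_limit_ge N_indep N_normal q01 q2 S_lim.
set m := fine (\int[P]_o (S o)%:E)%E.
have mE : (\int[P]_o (S o)%:E)%E = m%:E by rewrite fineK.
have varS : (\int[P]_w ((S w - m) ^+ 2)%:E <= ((1 - q ^+ 2)^-1)%:E)%E.
  by apply: variance_le_mgf.
(* A nonnegative mean keeps the level [t + m] of the lower tail bound nonnegative, and makes [m] the
   square root of its square. *)
have m0 : 0 <= m.
  rewrite -lee_fin -mE; apply: le_trans lower; rewrite lee_fin divr_ge0// mulr_ge0//.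
  by clear -q01; lra.
have upper : ('E_P[S] <= (Num.sqrt (2 / (1 - 2 * kappa)))%:E)%E.
  rewrite ES mE lee_fin -[m]ger0_norm// -sqrtr_sqr ler_wsqrtr// -qk.
  apply: sqr_mean_le; first exact: (integrable_limit N_indep N_normal q01 q2 S_lim).
  exact: (second_moment_limit N_indep N_normal q01 q2 S_lim).
split=> [//|]; split.
  (* The plain function [Sn] becomes the random variable [tree_max], which supplies measurability
     and integrability. *)
  move=> n _ -> t; rewrite SnE; apply: tailE => //.
  - by apply: integrable_fin_num => //; exact: (integrable_tree_max N_normal _ n [::]).
  - exact: mgf_tree_max.
split.
  under eq_fun do rewrite expectation_deviation_set//.
  rewrite -/m.
  have mD t : measurable [set o | (t <= `|S o - m|)%R].
    apply: (measurable_set_le (measurable_cst t)); apply: measurableT_comp => //.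
    by apply: measurable_funB => //; exact: measurable_funPT.
  apply: (@gaussian_rate R _ kappa m (ln (normal_peak 1))) => //.
  - by clear -k0 k2; lra.
  - move=> t t0; rewrite -lee_fin fineK; last exact: fin_num_measure (mD t).
    by have := tailS t t0; rewrite expectation_deviation_set.
  - move=> n t t0; rewrite -lee_fin fineK; last exact: fin_num_measure (mD t).
    have tm0 : 0 <= t + m by rewrite addr_ge0// ltW.
    (* The level is [t + m] because [t + m <= S] forces [t <= S - m]; and [S_n <= S] holds almost
       surely. *)
    rewrite -qk; apply: le_trans (tree_max_tail_ge N_indep N_normal q01 n tm0) _.
    apply: le_measure_ae => //.
      by apply: (measurable_set_le (measurable_cst _)); exact: measurable_funPT.
    apply: filterS (tree_max_le_limit q01 S_lim) => o So /= h.
    rewrite ler_normr lerBrDr; apply/orP; left.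
    exact: le_trans (So n.+1).
split; first by rewrite ES.
split=> [//|]; split.
  rewrite /variance covariance.unlock ES -/m expectation.unlock div1r -qk.
  by apply: le_trans varS; under eq_integral do rewrite -expr2.
move=> aE; rewrite aE in kappaE.
have [na nb] := numeric_bounds kappaE.
eexists; eexists; split; [reflexivity|reflexivity|exact: na|exact: nb|].
by rewrite ES in upper *; rewrite lower.
Qed.
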